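(* Let $\mu$ be a probability distribution on the nonnegative integers and denote by $F_\mu$ its generating function. Assume that there exist $\alpha\in(1,2]$ and a slowly varying function $L:\mathbb R_+\to\mathbb R_+^*$ such that $$F_\mu(1-s)-(1-s)\ \underset{s\downarrow0}{\sim}\ s^\alpha L\left(\frac1s\right).$$ Then, as $|\omega|\to0$ with $\omega\in\mathbb C$ and $|1+\omega|<1$, $$F_\mu(1+\omega)-(1+\omega)\ \sim\ (-\omega)^\alpha L\left(\frac1{|\omega|}\right).$$
   Context: $F_\mu(z)=\sum_{k\ge0}\mu(k)z^k$ for $|z|\le1$. A function $L:\mathbb R_+\to\mathbb R_+^*=(0,\infty)$ is slowly varying if $L(cx)/L(x)\to1$ as $x\to+\infty$ for every $c>0$. For $z\in\mathbb C\setminus\mathbb R_-$ written $z=\rho e^{i\theta}$ with $\rho>0$, $\theta\in(-\pi,\pi)$, one sets $\log z=\log\rho+i\theta$ and $z^a=e^{a\log z}$ for $a\in\mathbb R$. For complex quantities, $A\sim B$ means $A/B\to1$. *)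

(* Defs.v *)
From Stdlib Require Import Reals Lra ClassicalEpsilon.
From Coquelicot Require Import Coquelicot.

Open Scope R_scope.

Definition probability_distribution (mu : nat -> R) : Prop :=
  (forall k, 0 <= mu k) /\ is_series mu 1.

(* Coquelicot's total [Series] is real-valued, so the complex sum is taken
   componentwise; [gen_fun_correct] identifies it with the sum in [C]. *)
Definition gen_fun (mu : nat -> R) (z : C) : C :=
  (Series (fun k => Re (mu k * z ^ k)%C), Series (fun k => Im (mu k * z ^ k)%C)).

(* Only the values of [L] on [0, +oo) matter. *)
Definition slowly_varying (L : R -> R) : Prop :=
  (forall x, 0 <= x -> 0 < L x) /\
  forall c, 0 < c -> is_lim (fun x => L (c * x) / L x) p_infty 1.

(* [is_arg z t] has no solution [t] when z lies on (-oo, 0), and several when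
   z = 0: [Carg] is meaningful only off the closed negative half-line. *)
Definition is_arg (z : C) (t : R) : Prop :=
  - PI < t < PI /\ z = (RtoC (Cmod z) * (cos t, sin t))%C.

Definition Carg (z : C) : R := epsilon (inhabits 0) (is_arg z).

Definition Cexp (z : C) : C := (RtoC (exp (Re z)) * (cos (Im z), sin (Im z)))%C.

Definition Clog (z : C) : C := (ln (Cmod z), Carg z).

Definition Cpower (z : C) (a : R) : C := Cexp (RtoC a * Clog z)%C.

Definition equivalent {T : Type} (F : (T -> Prop) -> Prop) (f g : T -> C) : Prop :=
  filterlim (fun x => (f x / g x)%C) F (locally (T := C_UniformSpace) (RtoC 1)).

Lemma is_series_C (a : nat -> C) (x y : R) :
  is_series (fun k => Re (a k)) x -> is_series (fun k => Im (a k)) y ->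
  is_series (K := C_AbsRing) (V := C_NormedModule) a (x, y).
Proof.
  intros Hx Hy.
  assert (E : forall n, sum_n (G := C_AbelianMonoid) a n =
    (sum_n (fun k => Re (a k)) n, sum_n (fun k => Im (a k)) n)).
  { induction n as [|n IH].
    - rewrite !sum_O. now destruct (a 0%nat).
    - rewrite !sum_Sn, IH. now destruct (a (S n)). }
  intros P [eps HP].
  assert (Hx' := Hx _ (locally_ball x eps)).
  assert (Hy' := Hy _ (locally_ball y eps)).
  unfold filtermap in *.
  generalize (filter_and _ _ Hx' Hy').
  apply filter_imp; intros n [H1 H2].
  apply HP. rewrite E. now split.
Qed.

Lemma gen_fun_correct (mu : nat -> R) (z : C) :
  probability_distribution mu -> Cmod z <= 1 ->
  is_series (K := C_AbsRing) (V := C_NormedModule)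
    (fun k => (RtoC (mu k) * z ^ k)%C) (gen_fun mu z).
Proof.
  intros [Hpos Hsum] Hz.
  assert (B : forall k, Cmod (mu k * z ^ k)%C <= mu k).
  { intros k. rewrite Cmod_mult, Cmod_pow, Cmod_R, Rabs_pos_eq by apply Hpos.
    rewrite <- (Rmult_1_r (mu k)) at 2.
    apply Rmult_le_compat_l; [apply Hpos|].
    rewrite <- (pow1 k). apply pow_incr. split; [apply Cmod_ge_0|exact Hz]. }
  apply is_series_C; apply Series_correct;
    apply (ex_series_le (K := R_AbsRing) (V := R_CompleteNormedModule) _ mu);
    try (exists 1; exact Hsum); intros k;
    refine (Rle_trans _ _ _ _ (B k)).
  - apply re_le_Cmod.
  - eapply Rle_trans; [apply Rmax_r|apply Rmax_Cmod].
Qed.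

Lemma is_arg_exists (z : C) : ~ (Im z = 0 /\ Re z <= 0) -> exists t, is_arg z t.
Proof.
  destruct z as [x y]; cbn [Re Im fst snd]; intros Hz.
  set (r := Cmod (x, y)).
  assert (Hr2 : r * r = x * x + y * y).
  { unfold r, Cmod; cbn [fst snd]. rewrite sqrt_sqrt; nra. }
  assert (Hr0 : 0 <= r) by apply Cmod_ge_0.
  assert (Hrx : 0 < r + x).
  { destruct (Req_dec y 0) as [->|Hy].
    - assert (0 < x) by (apply Rnot_le_lt; tauto). lra.
    - assert (0 < y * y) by nra. nra. }
  set (u := y / (r + x)).
  exists (2 * atan u).
  assert (Ha := atan_bound u).
  split; [lra|].
  fold r.
  assert (Hc : 0 < cos (atan u)) by (apply cos_gt_0; lra).
  assert (Hs : sin (atan u) = u * cos (atan u)).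
  { transitivity (tan (atan u) * cos (atan u)).
    - unfold tan. field. lra.
    - now rewrite tan_atan. }
  assert (H1 := sin2_cos2 (atan u)). unfold Rsqr in H1.
  assert (Hu : u * (r + x) = y) by (unfold u; field; lra).
  rewrite cos_2a, sin_2a. rewrite Hs in *.
  set (c := cos (atan u)) in *.
  assert (Hcc : c * c * (2 * r) = r + x).
  { assert (c * c * (u * u + 1) = 1) by nra.
    assert (Huu : (u * u + 1) * (r + x) = 2 * r).
    { apply Rmult_eq_reg_r with (r + x); [|lra].
      replace ((u * u + 1) * (r + x) * (r + x))
        with ((u * (r + x)) * (u * (r + x)) + (r + x) * (r + x)) by ring.
      rewrite Hu. nra. }
    rewrite <- Huu.
    replace (c * c * ((u * u + 1) * (r + x)))
      with (c * c * (u * u + 1) * (r + x)) by ring.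
    rewrite H. ring. }
  unfold Cmult, RtoC; cbn [fst snd].
  assert (Hrr : 2 * r = u * u * (r + x) + (r + x)) by nra.
  f_equal.
  - replace (r * (c * c - u * c * (u * c)) - 0 * (2 * (u * c) * c))
      with (c * c * (2 * r) * (1 - u * u) / 2) by field.
    rewrite Hcc. nra.
  - replace (r * (2 * (u * c) * c) + 0 * (c * c - u * c * (u * c)))
      with (c * c * (2 * r) * u) by ring.
    rewrite Hcc. lra.
Qed.

Lemma Carg_correct (z : C) : ~ (Im z = 0 /\ Re z <= 0) -> is_arg z (Carg z).
Proof. intros Hz. unfold Carg. apply epsilon_spec, is_arg_exists, Hz. Qed.

Lemma is_arg_unique (z : C) (s t : R) :
  z <> RtoC 0 -> is_arg z s -> is_arg z t -> s = t.
Proof.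
  intros Hz [Hs Es] [Ht Et].
  assert (Hr : 0 < Cmod z) by now apply Cmod_gt_0.
  set (r := Cmod z) in *. clearbody r.
  rewrite Es in Et. clear Es Hz.
  unfold Cmult, RtoC in Et; cbn [fst snd] in Et.
  injection Et as H1 H2.
  assert (Hc : cos s = cos t) by (apply Rmult_eq_reg_l with r; lra).
  assert (Hn : sin s = sin t) by (apply Rmult_eq_reg_l with r; lra).
  assert (H0 : sin (s / 2 - t / 2) = 0).
  { assert (Hd : cos (2 * (s / 2 - t / 2)) = 1).
    { replace (2 * (s / 2 - t / 2)) with (s - t) by field.
      rewrite cos_minus, Hc, Hn. generalize (sin2_cos2 t). unfold Rsqr. lra. }
    rewrite cos_2a_sin in Hd. nra. }
  destruct (Rtotal_order s t) as [H|[H|H]]; [|exact H|].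
  - assert (0 < sin (t / 2 - s / 2)) by (apply sin_gt_0; lra).
    replace (t / 2 - s / 2) with (- (s / 2 - t / 2)) in H3 by ring.
    rewrite sin_neg in H3. lra.
  - assert (0 < sin (s / 2 - t / 2)) by (apply sin_gt_0; lra). lra.
Qed.

(* Main.v *)
(* Write G(s) = F(1-s) - (1-s).  The hypothesis makes g = G restricted to (0,1]
   regularly varying of index alpha > 1 at 0, whence G(s) = o(s), mu has mean one, and
   G(s) = sum_k mu_k ((1-s)^k - 1 + k s).  Estimating each summand gives two bounds with
   absolute constants, valid on the closed disc:
   - |G(s) - G(s')| <= 12 |s - s'| g(r) / r  when |s|, |s'| <= r;
   - the remainder of order N >= 1 of the Taylor expansion of u -> G(r(1-u)) at u = 0 is at
     most 6 |u|^(N+1) g(r), because all its coefficients of order >= 2 are nonnegative.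
   Regular variation says g(r(1-v)) / g(r) -> (1-v)^alpha for real v; by the second bound
   the normalized Taylor coefficients converge to the binomial ones, so that
   G(r(1-u)) / g(r) -> (1-u)^alpha uniformly on |u| <= rho < 1.  The discs |s - r| <= rho r
   only cover sectors; a point s close to the imaginary axis is first moved to s + e |s|,
   at a cost O(e g(|s|)) by the first bound. *)

Require Import Defs.
From Stdlib Require Import Reals Lra Lia.
From Coquelicot Require Import Coquelicot.

(** Nothing is known of the tails of mu, only the values of g near 0, so every error has to be
    measured in units of g itself. This is done summand by summand: with E_k(r) = (1-r)^k - 1 + k r,
    which is nonnegative on [0,1], each quantity attached to k is bounded by an absolute constant
    times E_k(r). Multiplying by mu_k and summing gives the same constant times g(r); this last sum
    is g(r) precisely because the mean is one. The key inequality is E_k(r) >= k(k-1) r^2 /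
    (2(1+(k-1)r)), which is quadratic in k r when k r is small and linear when it is large. It
    dominates k r t for every t <= min((k-1) r, 2) with the factor 6, and the constants 6 and 12
    both come from there. The exponent enters twice: alpha > 1 forces mean one, and alpha <= 2 keeps
    the binomial coefficients bounded by 2 and the powers of bounded points under fixed
    constants. *)

Notation is_Cseries := (is_series (K := C_AbsRing) (V := C_NormedModule)).

(** * Complex and real series, truncations *)

Lemma is_Cseries_RtoC (a : nat -> R) (l : R) :
  is_series a l -> is_Cseries (fun k => RtoC (a k)) (RtoC l).
Proof.
  intros H. apply is_series_C; [exact H|].
  apply (is_series_ext (fun _ => 0)); [reflexivity|].
  apply filterlim_ext with (fun _ : nat => 0).
  - intros n. symmetry. rewrite sum_n_const. ring.
  - apply filterlim_const.
Qed.

Lemma is_Cseries_ext (a b : nat -> C) (l : C) :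
  (forall k, a k = b k) -> is_Cseries a l -> is_Cseries b l.
Proof. exact (is_series_ext a b l). Qed.

Lemma is_Cseries_plus (a b : nat -> C) (la lb : C) :
  is_Cseries a la -> is_Cseries b lb ->
  is_Cseries (fun k => (a k + b k)%C) (la + lb)%C.
Proof. exact (is_series_plus a b la lb). Qed.

Lemma is_Cseries_minus (a b : nat -> C) (la lb : C) :
  is_Cseries a la -> is_Cseries b lb ->
  is_Cseries (fun k => (a k - b k)%C) (la - lb)%C.
Proof. exact (is_series_minus a b la lb). Qed.

Lemma is_Cseries_scal (c : C) (a : nat -> C) (l : C) :
  is_Cseries a l -> is_Cseries (fun k => (c * a k)%C) (c * l)%C.
Proof. exact (is_series_scal c a l). Qed.

Lemma is_series_Rext (a b : nat -> R) (l : R) :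
  (forall k, a k = b k) -> is_series a l -> is_series b l.
Proof. exact (is_series_ext a b l). Qed.

Lemma is_series_Rscal (c : R) (a : nat -> R) (l : R) :
  is_series a l -> is_series (fun k => c * a k) (c * l).
Proof. exact (is_series_scal c a l). Qed.

Lemma is_series_Rplus (a b : nat -> R) (la lb : R) :
  is_series a la -> is_series b lb -> is_series (fun k => a k + b k) (la + lb).
Proof. exact (is_series_plus a b la lb). Qed.

Lemma is_series_Rminus (a b : nat -> R) (la lb : R) :
  is_series a la -> is_series b lb -> is_series (fun k => a k - b k) (la - lb).
Proof. exact (is_series_minus a b la lb). Qed.

Lemma is_Cseries_unique (a : nat -> C) (l l' : C) :
  is_Cseries a l -> is_Cseries a l' -> l = l'.
Proof.
  intros H H'. exact (filterlim_locally_unique _ l l' H H').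
Qed.

Lemma sum_n_nonneg_le (b : nat -> R) (l : R) (n : nat) :
  (forall k, 0 <= b k) -> is_series b l -> sum_n b n <= l.
Proof.
  intros Hb Hl.
  apply (is_lim_seq_incr_compare (sum_n b)); [exact Hl|].
  intros m. rewrite sum_Sn. unfold plus; simpl. specialize (Hb (S m)). lra.
Qed.

(** With [b k] a multiple of [mu k * excess k r], this is the passage from a termwise estimate to an
    estimate by the same multiple of [real_defect mu r]. *)
Lemma is_Cseries_Cmod_le (a : nat -> C) (b : nat -> R) (l : C) (B : R) :
  (forall k, Cmod (a k) <= b k) -> is_Cseries a l -> is_series b B ->
  Cmod l <= B.
Proof.
  intros Hab Ha Hb.
  assert (Hn : filterlim (fun n => Cmod (sum_n (G := C_AbelianMonoid) a n))
    eventually (locally (Cmod l))).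
  { apply (filterlim_comp _ _ _ _ _ _ _ _ Ha).
    exact (filterlim_norm (K := C_AbsRing) (V := C_NormedModule) l). }
  apply (is_lim_seq_le _ (fun _ => B) (Cmod l) B) with (2 := Hn) (3 := is_lim_seq_const B).
  intros n. apply Rle_trans with (sum_n b n).
  - clear - Hab. induction n as [|n IH].
    + rewrite !sum_O. apply Hab.
    + rewrite !sum_Sn. eapply Rle_trans; [apply Cmod_triangle|].
      apply Rplus_le_compat; [exact IH|apply Hab].
  - apply sum_n_nonneg_le; [|exact Hb].
    intros k. eapply Rle_trans; [apply Cmod_ge_0|apply Hab].
Qed.

Lemma is_series_Rle (a b : nat -> R) (la lb : R) :
  (forall k, a k <= b k) -> is_series a la -> is_series b lb -> la <= lb.
Proof.
  intros Hab Ha Hb.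
  apply (is_lim_seq_le (sum_n a) (sum_n b) la lb); [|exact Ha|exact Hb].
  intros n. now apply sum_n_m_le.
Qed.

Lemma pow_unit_interval (x : R) (k : nat) : 0 <= x <= 1 -> 0 <= x ^ k <= 1.
Proof.
  intros Hx. split; [apply pow_le; lra|].
  rewrite <- (pow1 k). apply pow_incr. lra.
Qed.

Definition trunc (a : nat -> R) (u : C) (N : nat) : C :=
  sum_n (G := C_AbelianMonoid) (fun n => (RtoC (a n) * u ^ n)%C) N.

Lemma trunc_O (a : nat -> R) (u : C) : trunc a u 0 = RtoC (a 0%nat).
Proof. unfold trunc. rewrite sum_O. simpl. ring. Qed.

Lemma trunc_S (a : nat -> R) (u : C) (N : nat) :
  trunc a u (S N) = (trunc a u N + RtoC (a (S N)) * u ^ S N)%C.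
Proof. unfold trunc. now rewrite sum_Sn. Qed.

(** * The Taylor coefficients of [(x + r u)^k] *)

(** These are the numbers binom(k,n) x^(k-n) r^n, given by Pascal's rule: they vanish for n > k
    without any subtraction of naturals, and every property follows by induction on k. *)
Fixpoint taylor_coef (x r : R) (k n : nat) : R :=
  match k, n with
  | O, O => 1
  | O, S _ => 0
  | S k, O => x * taylor_coef x r k O
  | S k, S n => x * taylor_coef x r k (S n) + r * taylor_coef x r k n
  end.

Lemma taylor_coef_0 (x r : R) (k : nat) : taylor_coef x r k 0 = x ^ k.
Proof. induction k as [|k IH]; simpl; [|rewrite IH]; reflexivity. Qed.

Lemma taylor_coef_1 (x r : R) (k : nat) :
  taylor_coef x r (S k) 1 = INR (S k) * r * x ^ k.
Proof.
  induction k as [|k IH]; [simpl; ring|].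
  change (taylor_coef x r (S (S k)) 1)
    with (x * taylor_coef x r (S k) 1 + r * taylor_coef x r (S k) 0).
  rewrite IH, taylor_coef_0, (S_INR (S k)). simpl pow. ring.
Qed.

Lemma taylor_coef_ge_0 (x r : R) (k n : nat) :
  0 <= x -> 0 <= r -> 0 <= taylor_coef x r k n.
Proof.
  intros Hx Hr. revert n.
  induction k as [|k IH]; intros [|n]; simpl; try lra.
  - apply Rmult_le_pos; auto.
  - apply Rplus_le_le_0_compat; apply Rmult_le_pos; auto.
Qed.

Lemma trunc_taylor_coef_S (x r : R) (k N : nat) (u : C) :
  (trunc (taylor_coef x r (S k)) u (S N) =
   RtoC x * trunc (taylor_coef x r k) u (S N) + RtoC r * u * trunc (taylor_coef x r k) u N)%C.
Proof.
  induction N as [|N IH].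
  - rewrite !trunc_S, !trunc_O. simpl taylor_coef.
    rewrite RtoC_plus, !RtoC_mult. simpl. ring.
  - rewrite trunc_S, IH, !trunc_S. simpl taylor_coef.
    rewrite RtoC_plus, !RtoC_mult. simpl. ring.
Qed.

Lemma sum_taylor_coef_S (x r : R) (k N : nat) :
  sum_n (taylor_coef x r (S k)) (S N) =
  x * sum_n (taylor_coef x r k) (S N) + r * sum_n (taylor_coef x r k) N.
Proof.
  induction N as [|N IH].
  - rewrite !sum_Sn, !sum_O. unfold plus; simpl. ring.
  - rewrite sum_Sn, IH, !sum_Sn. unfold plus; simpl. ring.
Qed.

Lemma Cmod_pow_affine_le (x r : R) (k : nat) (u : C) :
  0 <= x -> 0 <= r -> Cmod u <= 1 -> Cmod ((RtoC x + RtoC r * u) ^ k) <= (x + r) ^ k.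
Proof.
  intros Hx Hr Hu. rewrite Cmod_pow. apply pow_incr. split; [apply Cmod_ge_0|].
  eapply Rle_trans; [apply Cmod_triangle|].
  rewrite Cmod_mult, !Cmod_R, !Rabs_pos_eq by assumption.
  assert (H := Cmod_ge_0 u). nra.
Qed.

(* All coefficients are nonnegative, so the remainder at [u] is at most
   [|u|^(N+1)] times the remainder at [1]. *)
Lemma taylor_remainder (x r : R) (k N : nat) (u : C) :
  0 <= x -> 0 <= r -> Cmod u <= 1 ->
  Cmod ((RtoC x + RtoC r * u) ^ k - trunc (taylor_coef x r k) u N) <=
  Cmod u ^ S N * ((x + r) ^ k - sum_n (taylor_coef x r k) N).
Proof.
  intros Hx Hr Hu. assert (Hu0 := Cmod_ge_0 u). revert N.
  induction k as [|k IH]; intros N.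
  - assert (HN : trunc (taylor_coef x r 0) u N = RtoC 1 /\ sum_n (taylor_coef x r 0) N = 1).
    { induction N as [|N [IH1 IH2]].
      - rewrite trunc_O, sum_O. now split.
      - rewrite trunc_S, sum_Sn, IH1, IH2. unfold plus; simpl. split; [|ring].
        rewrite Cmult_0_l. ring. }
    destruct HN as [-> ->]. simpl ((_ + _) ^ 0)%C.
    replace (RtoC 1 - RtoC 1)%C with (RtoC 0) by ring. rewrite Cmod_0. simpl. lra.
  - assert (Hp := Cmod_pow_affine_le x r k u Hx Hr Hu).
    destruct N as [|N].
    (* For N = 0 the recurrence would call for the truncation of order -1, which is empty. The full
       power (x + r u)^k takes the place of that remainder, with the bound (x + r)^k. *)
    + rewrite trunc_O, sum_O. simpl taylor_coef.
      specialize (IH 0%nat). rewrite trunc_O, sum_O in IH.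
      replace ((RtoC x + RtoC r * u) ^ S k - RtoC (x * taylor_coef x r k 0))%C
        with (RtoC x * ((RtoC x + RtoC r * u) ^ k - RtoC (taylor_coef x r k 0))
              + RtoC r * (u * (RtoC x + RtoC r * u) ^ k))%C
        by (rewrite RtoC_mult; simpl; ring).
      eapply Rle_trans; [apply Cmod_triangle|].
      rewrite !Cmod_mult, !Cmod_R, !Rabs_pos_eq by assumption.
      simpl pow in *.
      apply Rle_trans with (x * (Cmod u * 1 * ((x + r) ^ k - taylor_coef x r k 0)) +
        r * (Cmod u * (x + r) ^ k)); [|right; ring].
      apply Rplus_le_compat; apply Rmult_le_compat_l; try assumption.
      apply Rmult_le_compat_l; assumption.
    + rewrite trunc_taylor_coef_S, sum_taylor_coef_S.
      assert (I1 := IH N). assert (I2 := IH (S N)). clear IH.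
      set (A := trunc _ u (S N)) in *. set (B := trunc _ u N) in *.
      set (p := ((RtoC x + RtoC r * u) ^ k)%C) in *.
      replace ((RtoC x + RtoC r * u) ^ S k - (RtoC x * A + RtoC r * u * B))%C
        with (RtoC x * (p - A) + RtoC r * (u * (p - B)))%C
        by (unfold p; simpl; ring).
      eapply Rle_trans; [apply Cmod_triangle|].
      rewrite !Cmod_mult, !Cmod_R, !Rabs_pos_eq by assumption.
      apply Rle_trans with
        (x * (Cmod u ^ S (S N) * ((x + r) ^ k - sum_n (taylor_coef x r k) (S N))) +
         r * (Cmod u * (Cmod u ^ S N * ((x + r) ^ k - sum_n (taylor_coef x r k) N))));
        [|right; simpl; ring].
      apply Rplus_le_compat; apply Rmult_le_compat_l; try assumption.
      apply Rmult_le_compat_l; assumption.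
Qed.

(** * The functions [(1 - s)^k - 1 + k s] *)

Definition excess (k : nat) (s : R) : R := (1 - s) ^ k - 1 + INR k * s.
Definition Cexcess (k : nat) (s : C) : C := ((1 - s) ^ k - 1 + RtoC (INR k) * s)%C.

(** Equivalent to (1-r)^k (1 + k r) <= 1, which is inductive because (1-r)(1+(k+1)r) <= 1 + k r. It
    is a lower bound for 1-(1-r)^k, complementary to Bernoulli's upper bound k r. *)
Lemma one_minus_pow_ge (k : nat) (r : R) :
  0 <= r <= 1 -> INR k * r <= (1 - (1 - r) ^ k) * (1 + INR k * r).
Proof.
  intros Hr.
  enough (H : (1 - r) ^ k * (1 + INR k * r) <= 1) by lra.
  induction k as [|k IH]; [simpl; lra|].
  rewrite S_INR. simpl pow.
  assert (H0 : 0 <= (1 - r) ^ k) by (apply pow_le; lra).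
  assert (Hk := pos_INR k).
  apply Rle_trans with ((1 - r) ^ k * (1 + INR k * r)); [|exact IH].
  rewrite (Rmult_comm (1 - r)), Rmult_assoc.
  apply Rmult_le_compat_l; [exact H0|].
  assert (0 <= (INR k * r) * r) by (apply Rmult_le_pos; [apply Rmult_le_pos|]; lra).
  nra.
Qed.

(** Passing from exponent k+1 to k+2 adds r(1-(1-r)^(k+1)) to the excess, and the previous bound
    makes this increment at least (k+1)r^2 / (1+(k+1)r). The denominator is cleared to keep the
    induction polynomial. *)
Lemma excess_S_ge (k : nat) (r : R) :
  0 <= r <= 1 ->
  r * r * (INR (S k) * INR k) <= 2 * (1 + INR k * r) * excess (S k) r.
Proof.
  intros Hr. induction k as [|k IH].
  - unfold excess. simpl. lra.
  - assert (Hk := pos_INR k). assert (Hp := one_minus_pow_ge (S k) r Hr).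
    assert (E : excess (S (S k)) r = excess (S k) r + r * (1 - (1 - r) ^ S k)).
    { unfold excess. rewrite (S_INR (S k)). simpl pow. ring. }
    rewrite E. rewrite !S_INR in *. set (m := INR k) in *. clearbody m.
    set (q := 1 - (1 - r) ^ S k) in *. clearbody q.
    set (e := excess (S k) r) in *. clearbody e.
    assert (He : 0 <= e).
    { destruct (Rle_lt_dec 0 e) as [h|h]; [exact h|].
      assert (0 <= r * r * ((m + 1) * m)) by (repeat apply Rmult_le_pos; lra).
      assert (0 <= m * r) by (apply Rmult_le_pos; lra). nra. }
    assert (0 <= e * r) by (apply Rmult_le_pos; lra).
    assert (r * ((m + 1) * r) <= r * (q * (1 + (m + 1) * r)))
      by (apply Rmult_le_compat_l; lra).
    nra.
Qed.

Lemma excess_ge_0 (k : nat) (r : R) : 0 <= r <= 1 -> 0 <= excess k r.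
Proof.
  intros Hr. destruct k as [|k]; [unfold excess; simpl; lra|].
  assert (H := excess_S_ge k r Hr).
  assert (0 <= INR k * r) by (apply Rmult_le_pos; [apply pos_INR|lra]).
  assert (0 <= r * r * (INR (S k) * INR k)).
  { repeat apply Rmult_le_pos; try apply pos_INR; lra. }
  nra.
Qed.

(** With y = k r, the two bounds on t give t(1+y) <= y + 2y = 3y when t >= 0; the factor 2 of the
    quadratic lower bound turns 3 into 6. *)
Lemma excess_S_dominates (k : nat) (r t : R) :
  0 <= r <= 1 -> t <= INR k * r -> t <= 2 -> INR (S k) * r * t <= 6 * excess (S k) r.
Proof.
  intros Hr H1 H2. assert (H := excess_S_ge k r Hr).
  assert (Hy : 0 <= INR k * r) by (apply Rmult_le_pos; [apply pos_INR|lra]).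
  assert (HS : 0 <= INR (S k) * r) by (apply Rmult_le_pos; [apply pos_INR|lra]).
  set (y := INR k * r) in *.
  assert (Ht : t * (1 + y) <= 3 * y) by (destruct (Rle_lt_dec 0 t); nra).
  apply Rmult_le_reg_l with (1 + y); [lra|].
  apply Rle_trans with (INR (S k) * r * (t * (1 + y))); [right; ring|].
  apply Rle_trans with (INR (S k) * r * (3 * y)).
  - apply Rmult_le_compat_l; assumption.
  - unfold y in *. lra.
Qed.

Lemma sum_n_ge_first_two (a : nat -> R) (N : nat) :
  (forall n, 0 <= a n) -> a 0%nat + a 1%nat <= sum_n a (S N).
Proof.
  intros Ha. induction N as [|N IH].
  - rewrite sum_Sn, sum_O. unfold plus; simpl. lra.
  - rewrite sum_Sn. unfold plus; simpl. specialize (Ha (S (S N))). lra.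
Qed.

(** Keeping only the first two coefficients for exponent k+1 leaves (k+1) r (1-(1-r)^k) minus the
    excess, and the product is dominated with t = 1-(1-r)^k. Two terms are required, whence the
    order [S N]. *)
Lemma taylor_tail_le (r : R) (k N : nat) :
  0 <= r <= 1 -> 1 - sum_n (taylor_coef (1 - r) r k) (S N) <= 6 * excess k r.
Proof.
  intros Hr.
  assert (Ht := sum_n_ge_first_two (taylor_coef (1 - r) r k) N
    ltac:(intros; apply taylor_coef_ge_0; lra)).
  rewrite taylor_coef_0 in Ht.
  destruct k as [|k].
  - unfold excess. simpl in *. lra.
  - rewrite taylor_coef_1 in Ht.
    assert (Hp : 0 <= (1 - r) ^ k) by (apply pow_le; lra).
    assert (Hb : 1 - (1 - r) ^ k <= INR k * r).
    { assert (H := excess_ge_0 k r Hr). unfold excess in H. lra. }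
    assert (H := excess_S_dominates k r (1 - (1 - r) ^ k) Hr Hb ltac:(lra)).
    assert (He := excess_ge_0 (S k) r Hr).
    unfold excess in *. lra.
Qed.

Lemma Cmod_pow_le_1 (j : nat) (z : C) : Cmod z <= 1 -> Cmod (z ^ j) <= 1.
Proof.
  intros Hz. rewrite Cmod_pow, <- (pow1 j). apply pow_incr.
  split; [apply Cmod_ge_0|exact Hz].
Qed.

Lemma Cmod_one_minus_pow_min (j : nat) (z : C) (r : R) :
  Cmod z <= 1 -> Cmod (1 - z) <= r -> Cmod (1 - z ^ j) <= Rmin (INR j * r) 2.
Proof.
  intros Hz Hr. apply Rmin_glb.
  - induction j as [|j IH].
    + simpl. replace (1 - 1)%C with (RtoC 0) by ring. rewrite Cmod_0. lra.
    + replace (1 - z ^ S j)%C with ((1 - z ^ j) + (1 - z) * z ^ j)%C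
        by (simpl; ring).
      eapply Rle_trans; [apply Cmod_triangle|].
      rewrite S_INR, Cmod_mult.
      assert (H1 := Cmod_pow_le_1 j z Hz).
      assert (H0 := Cmod_ge_0 (1 - z)). nra.
  - eapply Rle_trans; [apply Cmod_triangle|].
    rewrite Cmod_opp, Cmod_1. assert (H1 := Cmod_pow_le_1 j z Hz). lra.
Qed.

(* Telescoping: [z'^k - z^k - k (z' - z)] is [z' - z] times a sum of [k] terms
   [z'^i z^j - 1] with [i + j < k]; the factor [z'^a] makes the induction work. *)
Lemma pow_diff_linear_le (K : nat) (m : R) (z z' : C) :
  Cmod z <= 1 -> Cmod z' <= 1 ->
  (forall j, (j <= K)%nat -> Cmod (1 - z ^ j) <= m /\ Cmod (1 - z' ^ j) <= m) ->
  forall k a, (a + k <= S K)%nat ->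
  Cmod (z' ^ a * (z' ^ k - z ^ k) - RtoC (INR k) * (z' - z)) <=
  INR k * (Cmod (z' - z) * (2 * m)).
Proof.
  intros Hz Hz' Hm k. induction k as [|k IH]; intros a Ha.
  - simpl INR. replace (_ - _)%C with (RtoC 0) by (simpl; ring). rewrite Cmod_0. lra.
  - rewrite S_INR.
    replace (z' ^ a * (z' ^ S k - z ^ S k) - RtoC (INR k + 1) * (z' - z))%C
      with ((z' ^ S a * (z' ^ k - z ^ k) - RtoC (INR k) * (z' - z))
            - (z' - z) * ((1 - z' ^ a) * z ^ k + (1 - z ^ k)))%C
      by (rewrite RtoC_plus; simpl; ring).
    eapply Rle_trans; [apply Cmod_triangle|].
    rewrite Cmod_opp, Cmod_mult, Rmult_plus_distr_r, Rmult_1_l.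
    apply Rplus_le_compat; [apply IH; lia|].
    apply Rmult_le_compat_l; [apply Cmod_ge_0|].
    eapply Rle_trans; [apply Cmod_triangle|]. rewrite Cmod_mult.
    destruct (Hm k ltac:(lia)) as [H1 _]. destruct (Hm a ltac:(lia)) as [_ H2].
    assert (H3 := Cmod_pow_le_1 k z Hz).
    assert (H4 := Cmod_ge_0 (z ^ k)). assert (H5 := Cmod_ge_0 (1 - z' ^ a)). nra.
Qed.

Lemma Cexcess_lipschitz (k : nat) (s s' : C) (r : R) :
  0 < r <= 1 -> Cmod (1 - s) <= 1 -> Cmod (1 - s') <= 1 ->
  Cmod s <= r -> Cmod s' <= r ->
  Cmod (Cexcess k s - Cexcess k s') <= excess k r * (12 * Cmod (s - s') / r).
Proof.
  intros Hr H1 H2 Hs Hs'.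
  assert (Hd := Cmod_ge_0 (s - s')).
  assert (Hdr : 0 <= 12 * Cmod (s - s') / r).
  { apply Rmult_le_pos; [lra|]. left. apply Rinv_0_lt_compat. lra. }
  destruct k as [|k].
  - unfold Cexcess. simpl INR.
    replace (_ - _)%C with (RtoC 0) by (simpl; ring). rewrite Cmod_0.
    apply Rmult_le_pos; [apply excess_ge_0; lra|exact Hdr].
  (* The exponent is k+1 but [m] uses k: the telescoped powers have exponents at most k. This
     matters for exponent 1, where the excess vanishes and the bound must vanish too. The constant
     12 is 6 times the 2 of the telescoping bound. *)
  - set (m := Rmin (INR k * r) 2).
    assert (Hone : forall w : C, (1 - (1 - w))%C = w) by (intros; ring).
    assert (Hm : forall j, (j <= k)%nat ->
      Cmod (1 - (1 - s') ^ j) <= m /\ Cmod (1 - (1 - s) ^ j) <= m).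
    { intros j Hj.
      assert (Hjm : Rmin (INR j * r) 2 <= m).
      { apply Rle_min_compat_r, Rmult_le_compat_r; [lra|]. now apply le_INR. }
      split; eapply Rle_trans; try apply Hjm;
        apply Cmod_one_minus_pow_min; rewrite ?Hone; assumption. }
    assert (H := pow_diff_linear_le k m _ _ H2 H1 Hm (S k) 0 ltac:(lia)).
    replace ((1 - s) ^ 0 * ((1 - s) ^ S k - (1 - s') ^ S k) -
             RtoC (INR (S k)) * (1 - s - (1 - s')))%C
      with (Cexcess (S k) s - Cexcess (S k) s')%C in H
      by (unfold Cexcess; simpl; ring).
    replace (1 - s - (1 - s'))%C with (- (s - s'))%C in H by ring.
    rewrite Cmod_opp in H.
    assert (Hdom := excess_S_dominates k r m ltac:(lra) (Rmin_l _ _) (Rmin_r _ _)).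
    eapply Rle_trans; [exact H|].
    replace (excess (S k) r * (12 * Cmod (s - s') / r))
      with (2 * Cmod (s - s') / r * (6 * excess (S k) r)) by (field; lra).
    replace (INR (S k) * (Cmod (s - s') * (2 * m)))
      with (2 * Cmod (s - s') / r * (INR (S k) * r * m)) by (field; lra).
    apply Rmult_le_compat_l; [|exact Hdom].
    apply Rmult_le_pos; [lra|]. left. apply Rinv_0_lt_compat. lra.
Qed.

(** * The defect F(1-s) - (1-s), complex and real *)

Definition defect (mu : nat -> R) (s : C) : C := (gen_fun mu (1 - s) - (1 - s))%C.

(** The function g of the overview. [Series] is total, so the value is meaningful where the sum
    converges; on [0,1] it agrees with [defect]. *)
Definition real_defect (mu : nat -> R) (r : R) : R :=
  Series (fun k => mu k * (1 - r) ^ k) - (1 - r).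

Lemma ex_series_mu_bounded (mu b : nat -> R) :
  probability_distribution mu -> (forall k, Rabs (b k) <= 1) ->
  ex_series (fun k => mu k * b k).
Proof.
  intros [Hpos Hsum] Hb.
  apply (ex_series_le (K := R_AbsRing) (V := R_CompleteNormedModule) _ mu);
    [|now exists 1].
  intros k. change (Rabs (mu k * b k) <= mu k).
  rewrite Rabs_mult, (Rabs_pos_eq (mu k)) by apply Hpos.
  specialize (Hpos k). specialize (Hb k). nra.
Qed.

Lemma real_gen_fun_series (mu : nat -> R) (r : R) :
  probability_distribution mu -> 0 <= r <= 1 ->
  is_series (fun k => mu k * (1 - r) ^ k) (real_defect mu r + (1 - r)).
Proof.
  intros Hmu Hr. unfold real_defect.
  replace (_ + _) with (Series (fun k => mu k * (1 - r) ^ k)) by ring.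
  apply Series_correct, ex_series_mu_bounded; [exact Hmu|].
  intros k. destruct (pow_unit_interval (1 - r) k ltac:(lra)).
  rewrite Rabs_pos_eq; lra.
Qed.

Lemma defect_RtoC (mu : nat -> R) (r : R) :
  probability_distribution mu -> 0 <= r <= 1 ->
  defect mu (RtoC r) = RtoC (real_defect mu r).
Proof.
  intros Hmu Hr. unfold defect.
  assert (E : gen_fun mu (1 - RtoC r) = RtoC (real_defect mu r + (1 - r))).
  { apply (is_Cseries_unique (fun k => RtoC (mu k) * (1 - RtoC r) ^ k)%C).
    - apply gen_fun_correct; [exact Hmu|].
      rewrite <- RtoC_minus, Cmod_R, Rabs_pos_eq; lra.
    - apply (is_Cseries_ext (fun k => RtoC (mu k * (1 - r) ^ k))).
      + intros k. now rewrite RtoC_mult, RtoC_pow, RtoC_minus.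
      + apply is_Cseries_RtoC. now apply real_gen_fun_series. }
  rewrite E, RtoC_plus, RtoC_minus. ring.
Qed.

(** * The mean equals one *)

(** The series of mu_k (1-(1-s)^k) has sum s - g(s), and its terms lie between mu_k k s / (1 + k s)
    and mu_k k s. Dividing by s along points where g(s)/s is small squeezes the mean to 1. *)
Lemma mean_one (mu : nat -> R) :
  probability_distribution mu ->
  (forall eps delta, 0 < eps -> 0 < delta -> exists s,
     0 < s < delta /\ s <= 1 /\ Rabs (real_defect mu s) <= eps * s) ->
  is_series (fun k => mu k * INR k) 1.
Proof.
  intros Hmu Hsmall. destruct (Hmu) as [Hpos Hsum].
  assert (Hcomp : forall s, 0 <= s <= 1 ->
    is_series (fun k => mu k * (1 - (1 - s) ^ k)) (s - real_defect mu s)).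
  { intros s Hs.
    replace (s - real_defect mu s) with (1 - (real_defect mu s + (1 - s))) by ring.
    apply is_series_ext with (fun k => mu k - mu k * (1 - s) ^ k).
    { intros k. simpl. ring. }
    apply is_series_Rminus; [exact Hsum|]. now apply real_gen_fun_series. }
  assert (Hterm : forall k, 0 <= mu k * INR k).
  { intros k. apply Rmult_le_pos; [apply Hpos|apply pos_INR]. }
  assert (Hup : forall K, sum_n (fun k => mu k * INR k) K <= 1).
  { intros K. apply le_epsilon. intros eps Heps.
    (* The partial sum will be at most (1+e)^2 <= 1 + 3e <= 1 + eps. One factor comes from K s <= e,
       the other from |g(s)| <= e s. *)
    set (e := Rmin 1 (eps / 4)).
    assert (He : 0 < e <= 1 /\ e <= eps / 4).
    { unfold e. repeat split; [apply Rmin_glb_lt; lra|apply Rmin_l|apply Rmin_r]. }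
    assert (HK : 0 < INR K + 1) by (generalize (pos_INR K); lra).
    destruct (Hsmall e (e / (INR K + 1))) as [s [[Hs0 Hs1] [Hs Hd]]]; [lra| |].
    { apply Rdiv_lt_0_compat; lra. }
    assert (HKs : INR K * s <= e).
    { apply Rmult_lt_compat_r with (r := INR K + 1) in Hs1; [|exact HK].
      unfold Rdiv in Hs1. rewrite Rmult_assoc, Rinv_l, Rmult_1_r in Hs1 by lra. lra. }
    assert (H1 : s * sum_n (fun k => mu k * INR k) K <=
                 (1 + e) * sum_n (fun k => mu k * (1 - (1 - s) ^ k)) K).
    { assert (forall n, (n <= K)%nat -> s * sum_n (fun k => mu k * INR k) n <=
         (1 + e) * sum_n (fun k => mu k * (1 - (1 - s) ^ k)) n) as H; [|now apply H].
      assert (Ht : forall n, (n <= K)%nat ->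
        s * (mu n * INR n) <= (1 + e) * (mu n * (1 - (1 - s) ^ n))).
      { intros n Hn. assert (H := one_minus_pow_ge n s ltac:(lra)).
        apply le_INR in Hn. assert (Hn0 := pos_INR n).
        assert (INR n * s <= e) by nra.
        destruct (pow_unit_interval (1 - s) n ltac:(lra)) as [_ Hp].
        apply Rle_trans with (mu n * ((1 - (1 - s) ^ n) * (1 + INR n * s))).
        - replace (s * (mu n * INR n)) with (mu n * (INR n * s)) by ring.
          apply Rmult_le_compat_l; [apply Hpos|exact H].
        - replace ((1 + e) * (mu n * (1 - (1 - s) ^ n)))
            with (mu n * ((1 - (1 - s) ^ n) * (1 + e))) by ring.
          apply Rmult_le_compat_l; [apply Hpos|].
          apply Rmult_le_compat_l; lra. }
      induction n as [|n IH]; intros Hn.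
      - rewrite !sum_O. now apply Ht.
      - rewrite !sum_Sn. unfold plus; simpl.
        specialize (IH ltac:(lia)). specialize (Ht (S n) Hn). simpl in Ht. lra. }
    assert (H2 : sum_n (fun k => mu k * (1 - (1 - s) ^ k)) K <= s - real_defect mu s).
    { apply sum_n_nonneg_le; [|apply Hcomp; lra]. intros k.
      destruct (pow_unit_interval (1 - s) k ltac:(lra)).
      apply Rmult_le_pos; [apply Hpos|lra]. }
    apply Rabs_le_between in Hd.
    apply Rmult_le_reg_l with s; [exact Hs0|].
    eapply Rle_trans; [exact H1|].
    apply Rle_trans with ((1 + e) * (s * (1 + e))).
    { apply Rmult_le_compat_l; lra. }
    replace ((1 + e) * (s * (1 + e))) with (s * (1 + (2 * e + e * e))) by ring.
    apply Rmult_le_compat_l; [lra|].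
    assert (e * e <= e) by nra. lra. }
  assert (Hex : ex_series (fun k => mu k * INR k)).
  { apply (ex_finite_lim_seq_incr _ 1); [|exact Hup].
    intros n. rewrite sum_Sn. unfold plus; simpl. specialize (Hterm (S n)).
    simpl in Hterm. lra. }
  destruct Hex as [m Hm].
  replace 1 with m; [exact Hm|]. apply Rle_antisym.
  - apply (is_lim_seq_le (sum_n (fun k => mu k * INR k)) (fun _ => 1) m 1 Hup Hm).
    apply is_lim_seq_const.
  - apply le_epsilon. intros eps Heps.
    destruct (Hsmall eps 1 Heps ltac:(lra)) as [s [[Hs0 _] [Hs Hd]]].
    apply Rabs_le_between in Hd.
    assert (H : s - real_defect mu s <= m * s).
    { apply (is_series_Rle (fun k => mu k * (1 - (1 - s) ^ k)) (fun k => mu k * INR k * s)).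
      - intros k. rewrite Rmult_assoc. apply Rmult_le_compat_l; [apply Hpos|].
        assert (H := excess_ge_0 k s ltac:(lra)). unfold excess in H. lra.
      - apply Hcomp; lra.
      - now apply is_series_scal_r. }
    apply Rmult_le_reg_l with s; lra.
Qed.

(** * Expansion of the defect for a distribution of mean one *)

Lemma defect_series (mu : nat -> R) (s : C) :
  probability_distribution mu -> is_series (fun k => mu k * INR k) 1 ->
  Cmod (1 - s) <= 1 ->
  is_Cseries (fun k => (RtoC (mu k) * Cexcess k s)%C) (defect mu s).
Proof.
  intros Hmu Hmean Hs. unfold defect.
  apply (is_Cseries_ext (fun k => RtoC (mu k) * (1 - s) ^ k - RtoC (mu k)
    + s * RtoC (mu k * INR k))%C).
  { intros k. unfold Cexcess. rewrite RtoC_mult.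
    ring. }
  replace (gen_fun mu (1 - s) - (1 - s))%C
    with (gen_fun mu (1 - s) - RtoC 1 + s * RtoC 1)%C by ring.
  apply is_Cseries_plus.
  - apply is_Cseries_minus.
    + now apply gen_fun_correct.
    + apply is_Cseries_RtoC, Hmu.
  - apply is_Cseries_scal. now apply is_Cseries_RtoC.
Qed.

Lemma real_defect_series (mu : nat -> R) (r : R) :
  probability_distribution mu -> is_series (fun k => mu k * INR k) 1 ->
  0 <= r <= 1 -> is_series (fun k => mu k * excess k r) (real_defect mu r).
Proof.
  intros Hmu Hmean Hr.
  apply (is_series_ext (fun k => mu k * (1 - r) ^ k - mu k + mu k * INR k * r)).
  { intros k. unfold excess. simpl. ring. }
  replace (real_defect mu r)
    with (real_defect mu r + (1 - r) - 1 + 1 * r) by ring.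
  apply is_series_Rplus.
  - apply is_series_Rminus; [now apply real_gen_fun_series|apply Hmu].
  - now apply is_series_scal_r.
Qed.

Lemma defect_lipschitz (mu : nat -> R) (s s' : C) (r : R) :
  probability_distribution mu -> is_series (fun k => mu k * INR k) 1 ->
  0 < r <= 1 -> Cmod (1 - s) <= 1 -> Cmod (1 - s') <= 1 ->
  Cmod s <= r -> Cmod s' <= r ->
  Cmod (defect mu s - defect mu s') <= real_defect mu r * (12 * Cmod (s - s') / r).
Proof.
  intros Hmu Hmean Hr H1 H2 Hs Hs'.
  apply (is_Cseries_Cmod_le
    (fun k => RtoC (mu k) * Cexcess k s - RtoC (mu k) * Cexcess k s')%C
    (fun k => mu k * excess k r * (12 * Cmod (s - s') / r))).
  - intros k.
    replace (RtoC (mu k) * Cexcess k s - RtoC (mu k) * Cexcess k s')%C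
      with (RtoC (mu k) * (Cexcess k s - Cexcess k s'))%C by ring.
    rewrite Cmod_mult, Cmod_R, Rabs_pos_eq, Rmult_assoc by apply Hmu.
    apply Rmult_le_compat_l; [apply Hmu|]. now apply Cexcess_lipschitz.
  - apply is_Cseries_minus; now apply defect_series.
  - apply is_series_scal_r, real_defect_series; [assumption..|lra].
Qed.

(* The Taylor coefficients of [u -> defect mu (r (1 - u))]; the subtracted terms come
   from [1 - r (1 - u) = (1 - r) + r u]. *)
Definition defect_coef (mu : nat -> R) (r : R) (n : nat) : R :=
  Series (fun k => mu k * taylor_coef (1 - r) r k n) -
  match n with O => 1 - r | S O => r | _ => 0 end.

(** At u = 1 the bound in [taylor_remainder] is 1 minus a partial sum and dominates a modulus, so
    the partial sums of these nonnegative coefficients are at most 1. Summability against mu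
    follows. *)
Lemma taylor_coef_le_1 (r : R) (k n : nat) :
  0 <= r <= 1 -> 0 <= taylor_coef (1 - r) r k n <= 1.
Proof.
  intros Hr. assert (H0 : forall n, 0 <= taylor_coef (1 - r) r k n)
    by (intros; apply taylor_coef_ge_0; lra).
  split; [apply H0|].
  assert (H := taylor_remainder (1 - r) r k n 1 ltac:(lra) ltac:(lra)
    ltac:(rewrite Cmod_1; lra)).
  rewrite Cmod_1, pow1 in H. replace (1 - r + r) with 1 in H by ring.
  rewrite pow1 in H.
  assert (Hc := Cmod_ge_0 ((RtoC (1 - r) + RtoC r * 1) ^ k -
                  trunc (taylor_coef (1 - r) r k) 1 n)).
  apply Rle_trans with (sum_n (taylor_coef (1 - r) r k) n); [|lra].
  clear H Hc. destruct n as [|n]; [rewrite sum_O; lra|].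
  rewrite sum_Sn. unfold plus; simpl.
  assert (0 <= sum_n (taylor_coef (1 - r) r k) n); [|lra].
  induction n as [|n IH]; [rewrite sum_O; apply H0|].
  rewrite sum_Sn. apply Rplus_le_le_0_compat; [exact IH|apply H0].
Qed.

(** From order 1 on the truncation contains the whole affine correction, so [defect_taylor] can
    cancel it and work with the generating function alone. *)
Lemma trunc_minus_affine (a : nat -> R) (b c : R) (u : C) (N : nat) :
  trunc (fun n => a n - match n with O => b | S O => c | _ => 0 end) u (S N) =
  (trunc a u (S N) - (RtoC b + RtoC c * u))%C.
Proof.
  induction N as [|N IH].
  - rewrite !trunc_S, !trunc_O, !RtoC_minus. simpl. ring.
  - rewrite trunc_S, IH, (trunc_S a u (S N)). cbv beta iota. rewrite RtoC_minus. ring.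
Qed.

Lemma defect_taylor (mu : nat -> R) (r : R) (u : C) (N : nat) :
  probability_distribution mu -> is_series (fun k => mu k * INR k) 1 ->
  0 <= r <= 1 -> Cmod u <= 1 ->
  Cmod (defect mu (RtoC r * (1 - u)) - trunc (defect_coef mu r) u (S N)) <=
  real_defect mu r * (6 * Cmod u ^ S (S N)).
Proof.
  intros Hmu Hmean Hr Hu.
  set (e := fun k n => taylor_coef (1 - r) r k n).
  set (E := fun n => Series (fun k => mu k * e k n)).
  assert (HE : forall n, is_series (fun k => mu k * e k n) (E n)).
  { intros n. apply Series_correct, ex_series_mu_bounded; [exact Hmu|].
    intros k. destruct (taylor_coef_le_1 r k n Hr). unfold e. rewrite Rabs_pos_eq; lra. }
  assert (HT : forall M, is_Cseries (fun k => RtoC (mu k) * trunc (e k) u M)%C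
                                    (trunc E u M)).
  { induction M as [|M IH].
    - rewrite trunc_O. eapply is_Cseries_ext; [|exact (is_Cseries_RtoC _ _ (HE 0%nat))].
      intros k. simpl. now rewrite trunc_O, RtoC_mult.
    - rewrite trunc_S.
      apply (is_Cseries_ext (fun k => RtoC (mu k) * trunc (e k) u M +
        u ^ S M * RtoC (mu k * e k (S M)))%C).
      + intros k. rewrite trunc_S, RtoC_mult. ring.
      + apply is_Cseries_plus; [exact IH|].
        rewrite Cmult_comm. apply is_Cseries_scal, is_Cseries_RtoC, HE. }
  assert (Harg : (1 - RtoC r * (1 - u))%C = (RtoC (1 - r) + RtoC r * u)%C)
    by (rewrite RtoC_minus; ring).
  assert (Hmod : Cmod (RtoC (1 - r) + RtoC r * u) <= 1).
  { assert (H := Cmod_pow_affine_le (1 - r) r 1 u ltac:(lra) ltac:(lra) Hu).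
    rewrite Cpow_1_r in H. simpl in H. lra. }
  replace (defect mu (RtoC r * (1 - u)) - trunc (defect_coef mu r) u (S N))%C
    with (gen_fun mu (RtoC (1 - r) + RtoC r * u) - trunc E u (S N))%C.
  2:{ unfold defect_coef. rewrite trunc_minus_affine. unfold defect.
      rewrite Harg. unfold E, e. ring. }
  apply (is_Cseries_Cmod_le
    (fun k => RtoC (mu k) * (RtoC (1 - r) + RtoC r * u) ^ k
              - RtoC (mu k) * trunc (e k) u (S N))%C
    (fun k => mu k * excess k r * (6 * Cmod u ^ S (S N)))).
  - intros k.
    replace (RtoC (mu k) * (RtoC (1 - r) + RtoC r * u) ^ k
              - RtoC (mu k) * trunc (e k) u (S N))%C
      with (RtoC (mu k) * ((RtoC (1 - r) + RtoC r * u) ^ k - trunc (e k) u (S N)))%C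
      by ring.
    rewrite Cmod_mult, Cmod_R, Rabs_pos_eq, Rmult_assoc by apply Hmu.
    apply Rmult_le_compat_l; [apply Hmu|].
    eapply Rle_trans; [apply taylor_remainder; lra|].
    replace (1 - r + r) with 1 by ring. rewrite pow1.
    rewrite (Rmult_comm 6), <- Rmult_assoc, (Rmult_comm (excess k r)), Rmult_assoc.
    apply Rmult_le_compat_l; [apply pow_le, Cmod_ge_0|].
    rewrite Rmult_comm. now apply taylor_tail_le.
  - apply is_Cseries_minus; [|apply HT]. now apply gen_fun_correct.
  - apply is_series_scal_r. now apply real_defect_series.
Qed.

Lemma defect_coef_0 (mu : nat -> R) (r : R) :
  defect_coef mu r 0 = real_defect mu r.
Proof.
  unfold defect_coef, real_defect. f_equal. apply Series_ext.
  intros k. now rewrite taylor_coef_0.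
Qed.

(** * Complex powers in the right half-plane *)

(** Uniqueness of the argument replaces the chosen value by a differentiable formula. The right
    half-plane suffices because |1-s| < 1 forces Re s > 0. *)
Lemma Carg_right_half_plane (z : C) :
  0 < Re z -> Carg z = atan (Im z / Re z).
Proof.
  intros Hz. assert (Hz0 : z <> RtoC 0) by (intros ->; simpl in Hz; lra).
  apply (is_arg_unique z); [exact Hz0|apply Carg_correct; lra|].
  assert (Hb := atan_bound (Im z / Re z)). assert (Hpi := PI_RGT_0).
  split; [lra|].
  destruct z as [x y]; simpl in *.
  assert (Hr : 0 < Cmod (x, y)) by now apply Cmod_gt_0.
  assert (Hr2 : Cmod (x, y) ^ 2 = x ^ 2 + y ^ 2).
  { unfold Cmod; simpl fst; simpl snd. rewrite <- Rsqr_pow2, Rsqr_sqrt; nra. }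
  set (u := y / x) in *. set (r := Cmod (x, y)) in *. clearbody r.
  assert (Hc : 0 < cos (atan u)) by (apply cos_gt_0; lra).
  assert (Hs : sin (atan u) = u * cos (atan u)).
  { rewrite <- (tan_atan u) at 2. unfold tan. field. lra. }
  assert (H1 := sin2_cos2 (atan u)). unfold Rsqr in H1. rewrite Hs in *.
  set (c := cos (atan u)) in *. clearbody c.
  assert (Hy : y = u * x) by (unfold u; field; lra). clearbody u.
  assert (Hrc : r * c = x).
  (* r c and x have equal squares, and r c + x > 0 selects the sign. *)
  { assert (E : (r * c - x) * (r * c + x) = 0).
    { replace ((r * c - x) * (r * c + x)) with (r ^ 2 * (c * c) - x ^ 2) by ring.
      rewrite Hr2, Hy.
      replace ((x ^ 2 + (u * x) ^ 2) * (c * c) - x ^ 2)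
        with (x ^ 2 * (u * c * (u * c) + c * c - 1)) by ring.
      rewrite H1. ring. }
    assert (0 < r * c) by (apply Rmult_lt_0_compat; lra).
    apply Rmult_integral in E. lra. }
  unfold Cmult, RtoC; simpl. f_equal.
  - rewrite <- Hrc. ring.
  - rewrite Hy, <- Hrc. ring.
Qed.

Lemma ln_Cmod (x y : R) : 0 < x -> ln (Cmod (x, y)) = ln (x ^ 2 + y ^ 2) / 2.
Proof.
  intros Hx. unfold Cmod; simpl fst; simpl snd.
  assert (H : 0 < x ^ 2 + y ^ 2) by (assert (0 < x * x) by nra; nra).
  rewrite <- (sqrt_sqrt (x ^ 2 + y ^ 2)) at 2 by lra.
  rewrite ln_mult by now apply sqrt_lt_R0. field.
Qed.

Lemma Cpower_polar (x y a : R) : 0 < x ->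
  Cpower (x, y) a = (exp (a * (ln (x ^ 2 + y ^ 2) / 2)) * cos (a * atan (y / x)),
                     exp (a * (ln (x ^ 2 + y ^ 2) / 2)) * sin (a * atan (y / x))).
Proof.
  intros Hx. unfold Cpower, Cexp, Clog.
  rewrite Carg_right_half_plane, ln_Cmod by (simpl; lra).
  unfold Cmult, RtoC; cbn [fst snd Re Im].
  f_equal; rewrite ?Rmult_0_l, ?Rminus_0_r, ?Rplus_0_r; f_equal; f_equal; ring.
Qed.

Lemma Cmod_Cpower (z : C) (a : R) : Cmod (Cpower z a) = Rpower (Cmod z) a.
Proof.
  unfold Cpower, Cexp. rewrite Cmod_mult, Cmod_R, Rabs_pos_eq by (left; apply exp_pos).
  unfold Cmod at 1; cbn [fst snd].
  assert (H := sin2_cos2 (Im (RtoC a * Clog z))). unfold Rsqr in H.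
  replace (cos (Im (RtoC a * Clog z)) ^ 2 + sin (Im (RtoC a * Clog z)) ^ 2) with 1 by lra.
  rewrite sqrt_1, Rmult_1_r. unfold Rpower. f_equal.
  unfold Clog, Cmult, RtoC; cbn [fst snd Re Im]. ring.
Qed.

Lemma Cpower_opp (z : C) (a : R) : 0 < Re z -> (Cpower z (- a) * Cpower z a)%C = RtoC 1.
Proof.
  intros Hz. destruct z as [x y]. rewrite !Cpower_polar by assumption.
  set (l := ln (x ^ 2 + y ^ 2) / 2). set (t := atan (y / x)).
  replace (- a * l) with (- (a * l)) by ring. replace (- a * t) with (- (a * t)) by ring.
  rewrite cos_neg, sin_neg.
  assert (He : exp (- (a * l)) * exp (a * l) = 1).
  { rewrite <- exp_plus. replace (_ + _) with 0 by ring. apply exp_0. }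
  assert (H := sin2_cos2 (a * t)). unfold Rsqr in H.
  unfold Cmult, RtoC; cbn [fst snd]. f_equal.
  - match goal with |- ?A = _ => replace A with
      (exp (- (a * l)) * exp (a * l) * (sin (a * t) * sin (a * t) + cos (a * t) * cos (a * t)))
      by ring end. rewrite He, H. ring.
  - ring.
Qed.

Lemma Cpower_RtoC (r a : R) : 0 < r -> Cpower (RtoC r) a = RtoC (Rpower r a).
Proof.
  intros Hr. unfold Cpower, Cexp, Clog. rewrite Carg_right_half_plane by exact Hr.
  replace (Im (RtoC r) / Re (RtoC r)) with 0 by (simpl; field; lra).
  rewrite Cmod_R, Rabs_pos_eq, atan_0 by lra. unfold RtoC; simpl.
  unfold Cmult; simpl.
  replace (a * 0 + 0 * ln r) with 0 by ring.
  replace (a * ln r - 0 * 0) with (a * ln r) by ring.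
  rewrite cos_0, sin_0. unfold Rpower. f_equal; ring.
Qed.

Lemma Cpower_scale (r a : R) (z : C) : 0 < r -> 0 < Re z ->
  Cpower (RtoC r * z) a = (RtoC (Rpower r a) * Cpower z a)%C.
Proof.
  intros Hr Hz. assert (Hrz : 0 < Re (RtoC r * z)).
  { rewrite re_scal_l. now apply Rmult_lt_0_compat. }
  unfold Cpower, Cexp, Clog. rewrite !Carg_right_half_plane by assumption.
  rewrite re_scal_l, im_scal_l.
  assert (Hz0 : z <> RtoC 0) by (intros ->; simpl in Hz; lra).
  rewrite Cmod_mult, Cmod_R, Rabs_pos_eq, ln_mult by (try apply Cmod_gt_0; lra || assumption).
  unfold Rpower, Cmult, RtoC; cbn [fst snd Re Im].
  rewrite !Rmult_0_l, !Rminus_0_r, !Rplus_0_r, Rmult_plus_distr_l, exp_plus.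
  change (fst z) with (Re z).
  replace (r * Im z / (r * Re z)) with (Im z / Re z) by (field; lra).
  f_equal; ring.
Qed.

(** The derivative along a line is characterized by w D = a q w^a rather than as a q w^(a-1): this
    is the form in which it is combined with the differential equation of the binomial series. *)
Lemma Cpower_derive (p q : C) (a t : R) :
  0 < Re (p + RtoC t * q) ->
  exists D : C,
    is_derive (fun t => Re (Cpower (p + RtoC t * q) a)) t (Re D) /\
    is_derive (fun t => Im (Cpower (p + RtoC t * q) a)) t (Im D) /\
    ((p + RtoC t * q) * D = RtoC a * q * Cpower (p + RtoC t * q) a)%C.
Proof.
  destruct p as [x0 y0]. destruct q as [x1 y1]. intros Ht.
  set (X := fun t => x0 + t * x1). set (Y := fun t => y0 + t * y1).
  assert (E : forall t, ((x0, y0) + RtoC t * (x1, y1))%C = (X t, Y t)).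
  { intros s. unfold X, Y, Cplus, Cmult, RtoC; simpl. f_equal; ring. }
  rewrite E in Ht. simpl in Ht.
  set (l := fun t => ln (X t ^ 2 + Y t ^ 2) / 2).
  set (th := fun t => atan (Y t / X t)).
  assert (Hloc : locally t (fun t => 0 < X t)).
  { apply (continuous_comp X (fun x => x) t); [|apply continuous_id|].
    - apply (ex_derive_continuous X). unfold X. auto_derive. trivial.
    - now apply open_gt. }
  assert (Hs : 0 < X t ^ 2 + Y t ^ 2).
  { assert (0 < X t * X t) by nra. nra. }
  set (l' := (X t * x1 + Y t * y1) / (X t ^ 2 + Y t ^ 2)).
  set (th' := (X t * y1 - Y t * x1) / (X t ^ 2 + Y t ^ 2)).
  exists (exp (a * l t) * (a * l' * cos (a * th t) - a * th' * sin (a * th t)),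
     exp (a * l t) * (a * l' * sin (a * th t) + a * th' * cos (a * th t))).
  assert (Dl : is_derive l t l').
  { unfold l, l', X, Y in *. auto_derive; [lra|]. field. lra. }
  assert (Dth : is_derive th t th').
  { unfold th, th', X, Y in *. auto_derive; [lra|]. field. split; lra. }
  split; [|split].
  - apply (is_derive_ext_loc (fun t => exp (a * l t) * cos (a * th t))).
    { revert Hloc. apply filter_imp. intros s Hs'. rewrite E, Cpower_polar by exact Hs'.
      reflexivity. }
    cbn [Re fst]. auto_derive.
    { split; [now exists l'|split; [now exists th'|trivial]]. }
    replace (Derive (fun x : R => l x) t) with l'
      by (symmetry; exact (is_derive_unique _ _ _ Dl)).
    replace (Derive (fun x : R => th x) t) with th'
      by (symmetry; exact (is_derive_unique _ _ _ Dth)).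
    ring.
  - apply (is_derive_ext_loc (fun t => exp (a * l t) * sin (a * th t))).
    { revert Hloc. apply filter_imp. intros s Hs'. rewrite E, Cpower_polar by exact Hs'.
      reflexivity. }
    cbn [Im snd]. auto_derive.
    { split; [now exists l'|split; [now exists th'|trivial]]. }
    replace (Derive (fun x : R => l x) t) with l'
      by (symmetry; exact (is_derive_unique _ _ _ Dl)).
    replace (Derive (fun x : R => th x) t) with th'
      by (symmetry; exact (is_derive_unique _ _ _ Dth)).
    ring.
  - rewrite E, Cpower_polar by exact Ht. fold (l t) (th t).
    unfold Cmult, RtoC; cbn [fst snd]. unfold l', th'. f_equal; field; lra.
Qed.

(** * The binomial series in the complex unit disc *)

(** The coefficient of u^n in (1-u)^a, that is (-1)^n binom(a,n). *)
Fixpoint binom_coef (a : R) (n : nat) : R :=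
  match n with
  | O => 1
  | S n => - binom_coef a n * (a - INR n) / INR (S n)
  end.

(** Only the first ratio, of modulus a, can exceed 1; all later ones |a-n|/(n+1) are at most 1.
    Hence the induction starts at n = 1. *)
Lemma binom_coef_le_2 (a : R) (n : nat) : 0 <= a <= 2 -> Rabs (binom_coef a n) <= 2.
Proof.
  intros Ha. destruct n as [|n]; [simpl; rewrite Rabs_R1; lra|].
  induction n as [|n IH].
  - simpl. replace (- (1) * (a - 0) / 1) with (- a) by field.
    rewrite Rabs_Ropp, Rabs_pos_eq; lra.
  - change (binom_coef a (S (S n)))
      with (- binom_coef a (S n) * (a - INR (S n)) / INR (S (S n))).
    set (b := binom_coef a (S n)) in *.
    rewrite (S_INR (S n)). assert (Hn := pos_INR n). rewrite (S_INR n).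
    set (m := INR n) in *.
    unfold Rdiv. rewrite Rmult_assoc, Rabs_mult, Rabs_Ropp.
    assert (H : Rabs ((a - (m + 1)) * / (m + 1 + 1)) <= 1).
    { rewrite Rabs_mult, (Rabs_pos_eq (/ _)) by (left; apply Rinv_0_lt_compat; lra).
      apply Rmult_le_reg_r with (m + 1 + 1); [lra|].
      rewrite Rmult_assoc, Rinv_l, Rmult_1_r by lra. apply Rabs_le. lra. }
    assert (H1 := Rabs_pos b). assert (H2 := Rabs_pos ((a - (m + 1)) * / (m + 1 + 1))).
    nra.
Qed.

Lemma im_le_Cmod (z : C) : Rabs (Im z) <= Cmod z.
Proof. eapply Rle_trans; [apply Rmax_r|apply Rmax_Cmod]. Qed.

Lemma CV_radius_gt_1 (b : nat -> R) (rho t : R) :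
  0 <= rho < 1 -> (forall n, Rabs (b n) <= 2 * rho ^ n) -> 0 <= t <= 1 ->
  Rbar_lt (Rabs t) (CV_radius b).
Proof.
  intros Hrho Hb Ht.
  (* The reciprocal of the midpoint of rho and 1: it exceeds 1, and its product with rho stays at
     most 1, also for rho = 0. *)
  apply Rbar_lt_le_trans with (2 / (1 + rho)).
  - simpl. rewrite Rabs_pos_eq by lra. apply Rle_lt_trans with 1; [lra|].
    apply Rmult_lt_reg_r with (1 + rho); [lra|].
    replace (2 / (1 + rho) * (1 + rho)) with 2 by (field; lra). lra.
  - apply (CV_radius_bounded b). exists 2. intros n.
    rewrite Rabs_mult, <- RPow_abs.
    assert (Hq : 0 < 2 / (1 + rho)) by (apply Rdiv_lt_0_compat; lra).
    rewrite (Rabs_pos_eq (2 / _)) by lra.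
    apply Rle_trans with (2 * rho ^ n * (2 / (1 + rho)) ^ n).
    + apply Rmult_le_compat_r; [apply pow_le; lra|apply Hb].
    + rewrite Rmult_assoc, <- Rpow_mult_distr.
      assert (Hx : 0 <= rho * (2 / (1 + rho)) <= 1).
      { split; [apply Rmult_le_pos; lra|].
        apply Rmult_le_reg_r with (1 + rho); [lra|].
        replace (rho * (2 / (1 + rho)) * (1 + rho)) with (2 * rho) by (field; lra). lra. }
      assert (H := pow_unit_interval _ n Hx). lra.
Qed.

(** The factor t keeps the exponents of t f' aligned with those of f, so the differential equation
    can be checked coefficient by coefficient. *)
Lemma PSeries_derive_scaled (b : nat -> R) (t : R) :
  Rbar_lt (Rabs t) (CV_radius b) ->
  is_series (fun n => INR n * b n * t ^ n) (t * PSeries (PS_derive b) t).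
Proof.
  intros Ht.
  apply (is_series_Rext (fun n => PS_incr_1 (PS_derive b) n * t ^ n)).
  { intros [|n]; [|reflexivity]. change (0 * 1 = 0 * b 0%nat * 1). now rewrite !Rmult_0_l. }
  rewrite <- PSeries_incr_1. apply Series_correct.
  apply ex_pseries_R, CV_radius_inside.
  now rewrite CV_radius_incr_1, CV_radius_derive.
Qed.

Lemma PSeries_is_series (b : nat -> R) (t : R) :
  Rbar_lt (Rabs t) (CV_radius b) ->
  is_series (fun n => b n * t ^ n) (PSeries b t).
Proof.
  intros Ht. apply Series_correct, ex_pseries_R. now apply CV_radius_inside.
Qed.

Lemma is_derive_Rmult (f g : R -> R) (t df dg : R) :
  is_derive f t df -> is_derive g t dg ->
  is_derive (fun t => f t * g t) t (df * g t + f t * dg).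
Proof. intros Hf Hg. exact (is_derive_mult f g t df dg Hf Hg Rmult_comm). Qed.

(* Along [t -> f (t u)], the sum [f] satisfies [(1 - t u) f' = - a u f], which is
   also the equation of [(1 - t u)^a]; so [f (t u) (1 - t u)^(-a)] is constant. *)
Lemma binomial_series (a : R) (u : C) :
  0 <= a <= 2 -> Cmod u < 1 ->
  is_Cseries (fun n => RtoC (binom_coef a n) * u ^ n)%C (Cpower (1 - u) a).
Proof.
  intros Ha Hu.
  assert (Hu0 := Cmod_ge_0 u).
  (* [b] and [c] are the coefficients in t of the real and imaginary parts of f(t u). Since |u| < 1,
     the point t = 1 is strictly inside the disc of convergence. *)
  set (b := fun n => binom_coef a n * Re (u ^ n)).
  set (c := fun n => binom_coef a n * Im (u ^ n)).
  assert (Hbc : forall n, Rabs (b n) <= 2 * Cmod u ^ n /\ Rabs (c n) <= 2 * Cmod u ^ n).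
  { intros n. unfold b, c. rewrite !Rabs_mult, <- Cmod_pow.
    assert (H := binom_coef_le_2 a n Ha).
    split; apply Rmult_le_compat; try apply Rabs_pos; try exact H;
      [apply re_le_Cmod|apply im_le_Cmod]. }
  assert (Rb : forall t, 0 <= t <= 1 -> Rbar_lt (Rabs t) (CV_radius b)).
  { intros t Ht. apply (CV_radius_gt_1 b (Cmod u)); [lra|apply Hbc|exact Ht]. }
  assert (Rc : forall t, 0 <= t <= 1 -> Rbar_lt (Rabs t) (CV_radius c)).
  { intros t Ht. apply (CV_radius_gt_1 c (Cmod u)); [lra|apply Hbc|exact Ht]. }
  set (A := PSeries b). set (B := PSeries c).
  set (A' := PSeries (PS_derive b)). set (B' := PSeries (PS_derive c)).
  assert (Hstep : forall n, INR (S n) * binom_coef a (S n) = (INR n - a) * binom_coef a n).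
  { intros n. change (binom_coef a (S n))
      with (- binom_coef a n * (a - INR n) / INR (S n)). field.
    apply not_0_INR. lia. }
  assert (Hode : forall t, 0 <= t <= 1 ->
    ((1 - RtoC t * u) * (A' t, B' t) = - RtoC a * u * (A t, B t))%C).
  { intros t Ht.
    assert (Sb := PSeries_is_series b t (Rb t Ht)).
    assert (Sc := PSeries_is_series c t (Rc t Ht)).
    assert (Db := PSeries_derive_scaled b t (Rb t Ht)).
    assert (Dc := PSeries_derive_scaled c t (Rc t Ht)).
    fold A in Sb. fold B in Sc. fold A' in Db. fold B' in Dc.
    assert (EA : A' t = Re u * (t * A' t) - Im u * (t * B' t)
                        - a * (Re u * A t - Im u * B t)).
    { unfold A' at 1, PSeries. apply is_series_unique.
      apply (is_series_Rext (fun n => Re u * (INR n * b n * t ^ n)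
        - Im u * (INR n * c n * t ^ n)
        - a * (Re u * (b n * t ^ n) - Im u * (c n * t ^ n)))).
      { intros n. unfold PS_derive, b, c.
        transitivity ((INR n - a) * binom_coef a n * Re (u * u ^ n)%C * t ^ n).
        - unfold Re, Im. simpl. ring.
        - rewrite <- Hstep, Cpow_S. ring. }
      apply is_series_Rminus; [apply is_series_Rminus|apply is_series_Rscal];
        [| |apply is_series_Rminus]; apply is_series_Rscal; assumption. }
    assert (EB : B' t = Re u * (t * B' t) + Im u * (t * A' t)
                        - a * (Re u * B t + Im u * A t)).
    { unfold B' at 1, PSeries. apply is_series_unique.
      apply (is_series_Rext (fun n => Re u * (INR n * c n * t ^ n)
        + Im u * (INR n * b n * t ^ n)
        - a * (Re u * (c n * t ^ n) + Im u * (b n * t ^ n)))).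
      { intros n. unfold PS_derive, b, c.
        transitivity ((INR n - a) * binom_coef a n * Im (u * u ^ n)%C * t ^ n).
        - unfold Re, Im. simpl. ring.
        - rewrite <- Hstep, Cpow_S. ring. }
      apply is_series_Rminus; [apply is_series_Rplus|apply is_series_Rscal];
        [| |apply is_series_Rplus]; apply is_series_Rscal; assumption. }
    clear - EA EB. destruct u as [p q]. unfold Cmult, Cminus, Cplus, Copp, RtoC.
    simpl in *. f_equal; lra. }
  assert (Hre : forall t, 0 <= t <= 1 -> 0 < Re (1 + RtoC t * - u)).
  { intros t Ht. assert (H := re_le_Cmod u). apply Rabs_le_between in H.
    destruct u as [p q]. simpl in *. nra. }
  set (k := fun t => Cpower (1 + RtoC t * - u) (- a)).
  assert (Hd : forall t, 0 <= t <= 1 ->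
    is_derive (fun t => A t * Re (k t) - B t * Im (k t)) t 0 /\
    is_derive (fun t => A t * Im (k t) + B t * Re (k t)) t 0).
  { intros t Ht.
    destruct (Cpower_derive 1 (- u) (- a) t (Hre t Ht)) as [D [D1 [D2 D3]]].
    assert (DA : is_derive A t (A' t)) by now apply is_derive_PSeries, Rb.
    assert (DB : is_derive B t (B' t)) by now apply is_derive_PSeries, Rc.
    (* After multiplication by w = 1 - t u, the first product becomes -a u f k and the second a u f
       k. *)
    assert (H0 : ((A' t, B' t) * k t + (A t, B t) * D = 0)%C).
    { assert (Hnz : (1 + RtoC t * - u)%C <> RtoC 0).
      { intros E. specialize (Hre t Ht). rewrite E in Hre. simpl in Hre. lra. }
      assert (E1 := Hode t Ht). fold (k t) in D3.
      replace (1 - RtoC t * u)%C with (1 + RtoC t * - u)%C in E1 by ring.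
      set (w := (1 + RtoC t * - u)%C) in *.
      replace ((A' t, B' t) * k t + (A t, B t) * D)%C
        with (/ w * (w * (A' t, B' t) * k t + (A t, B t) * (w * D)))%C by (field; exact Hnz).
      rewrite E1, D3, RtoC_opp. ring. }
    assert (H1 : Re ((A' t, B' t) * k t + (A t, B t) * D)%C = 0) by now rewrite H0.
    assert (H2 : Im ((A' t, B' t) * k t + (A t, B t) * D)%C = 0) by now rewrite H0.
    simpl in H1, H2.
    fold (Re (k t)) (Im (k t)) (Re D) (Im D) in H1, H2.
    split.
    - evar_last.
      + apply @is_derive_minus; apply is_derive_Rmult; eassumption.
      + unfold minus, plus, opp; simpl. lra.
    - evar_last.
      + apply @is_derive_plus; apply is_derive_Rmult; eassumption.
      + unfold minus, plus, opp; simpl. lra. }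
  assert (H1 := eq_is_derive _ 0 1 (fun t Ht => proj1 (Hd t Ht)) Rlt_0_1).
  assert (H2 := eq_is_derive _ 0 1 (fun t Ht => proj2 (Hd t Ht)) Rlt_0_1).
  cbv beta in H1, H2.
  assert (HA0 : A 0 = 1) by (unfold A; rewrite PSeries_0; unfold b; simpl; ring).
  assert (HB0 : B 0 = 0) by (unfold B; rewrite PSeries_0; unfold c; simpl; ring).
  assert (Hk0 : k 0 = RtoC 1).
  { unfold k. replace (1 + RtoC 0 * - u)%C with (RtoC 1) by ring.
    rewrite Cpower_RtoC by lra. unfold Rpower. now rewrite ln_1, Rmult_0_r, exp_0. }
  assert (Hk1 : k 1 = Cpower (1 - u) (- a)).
  { unfold k. f_equal. ring. }
  assert (HAB : ((A 1, B 1) * Cpower (1 - u) (- a) = RtoC 1)%C).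
  { rewrite <- Hk1. rewrite Hk0, HA0, HB0 in H1, H2.
    clear - H1 H2. destruct (k 1) as [k1 k2]. unfold Cmult, RtoC.
    cbn [Re Im fst snd RtoC] in *. f_equal; lra. }
  assert (HP : Cpower (1 - u) a = (A 1, B 1)).
  { assert (Hz : 0 < Re (1 - u)).
    { specialize (Hre 1 ltac:(lra)). replace (1 - u)%C with (1 + RtoC 1 * - u)%C by ring.
      exact Hre. }
    transitivity ((A 1%R, B 1%R) * Cpower (1 - u) (- a) * Cpower (1 - u) a)%C.
    - rewrite HAB. ring.
    - rewrite <- Cmult_assoc, Cpower_opp by exact Hz. ring. }
  rewrite HP. apply is_series_C.
  - apply (is_series_Rext (fun n => b n * 1 ^ n)).
    + intros n. rewrite pow1, re_scal_l. unfold b. simpl. ring.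
    + apply PSeries_is_series, Rb. lra.
  - apply (is_series_Rext (fun n => c n * 1 ^ n)).
    + intros n. rewrite pow1, im_scal_l. unfold c. simpl. ring.
    + apply PSeries_is_series, Rc. lra.
Qed.

Lemma binomial_remainder (a : R) (u : C) (N : nat) :
  0 <= a <= 2 -> Cmod u < 1 ->
  Cmod (Cpower (1 - u) a - trunc (binom_coef a) u N) <= 2 / (1 - Cmod u) * Cmod u ^ S N.
Proof.
  intros Ha Hu. assert (Hu0 := Cmod_ge_0 u).
  apply (is_Cseries_Cmod_le
    (fun k => RtoC (binom_coef a (S N + k)) * u ^ (S N + k))%C
    (fun k => 2 * Cmod u ^ S N * Cmod u ^ k)).
  - intros k. rewrite Cmod_mult, Cmod_R, Cmod_pow, Rmult_assoc, <- pow_add.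
    apply Rmult_le_compat_r; [apply pow_le, Hu0|now apply binom_coef_le_2].
  - apply (is_series_incr_n (fun k => (RtoC (binom_coef a k) * u ^ k)%C) (S N)); [lia|].
    match goal with |- is_series _ ?l => replace l with (Cpower (1 - u) a) end.
    + now apply binomial_series.
    + change (Cpower (1 - u) a =
        Cpower (1 - u) a - trunc (binom_coef a) u N + trunc (binom_coef a) u N)%C. ring.
  - replace (2 / (1 - Cmod u) * Cmod u ^ S N)
      with (2 * Cmod u ^ S N * / (1 - Cmod u)) by (field; lra).
    apply is_series_Rscal, is_series_geom. rewrite Rabs_pos_eq; lra.
Qed.

Lemma Rpower_le_sqr (x a : R) : 1 <= x -> a <= 2 -> Rpower x a <= x * x.
Proof.
  intros Hx Ha. replace (x * x) with (Rpower x (INR 2)).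
  - apply Rle_Rpower; [exact Hx|simpl; lra].
  - rewrite Rpower_pow by lra. simpl. ring.
Qed.

Lemma Cpower_shift_le (a e : R) (z : C) :
  1 <= a <= 2 -> 0 <= e <= 1 -> 0 < Re z -> Cmod z <= 1 ->
  Cmod (Cpower (z + RtoC e) a - Cpower z a) <= 12 * e.
Proof.
  intros Ha He Hz Hz1.
  set (f := fun t => Cpower (z + RtoC t * RtoC e) a).
  (* The mean value bound is taken on the ball of radius 1 centred at t = 1, which is [0,2]; a ball
     centred at 0 could leave the half-plane. There |w| <= 3, so the derivative is at most 2 e 3 =
     6e, and the two components together give 12e. *)
  assert (Hf : forall t, 0 <= t <= 2 -> exists D : C,
    is_derive (fun t => Re (f t)) t (Re D) /\
    is_derive (fun t => Im (f t)) t (Im D) /\ Cmod D <= 6 * e).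
  { intros t Ht. set (w := (z + RtoC t * RtoC e)%C).
    assert (Hw : 0 < Re w).
    { unfold w. simpl. fold (Re z). nra. }
    destruct (Cpower_derive z (RtoC e) a t Hw) as [D [D1 [D2 D3]]].
    exists D. split; [exact D1|split; [exact D2|]].
    fold w in D3.
    assert (Hw0 : 0 < Cmod w).
    { apply Cmod_gt_0. intros E. rewrite E in Hw. simpl in Hw. lra. }
    assert (Hw3 : Cmod w <= 3).
    { unfold w. eapply Rle_trans; [apply Cmod_triangle|].
      rewrite Cmod_mult, !Cmod_R, !Rabs_pos_eq by lra. nra. }
    apply (f_equal Cmod) in D3.
    rewrite !Cmod_mult, !Cmod_R, Cmod_Cpower, !Rabs_pos_eq in D3 by lra.
    replace a with (1 + (a - 1)) in D3 at 2 by ring.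
    rewrite Rpower_plus, Rpower_1 in D3 by exact Hw0.
    assert (HD : Cmod D = a * e * Rpower (Cmod w) (a - 1)).
    { apply Rmult_eq_reg_l with (Cmod w); [|lra]. rewrite D3. ring. }
    rewrite HD.
    assert (HP : Rpower (Cmod w) (a - 1) <= 3).
    { apply Rle_trans with (Rpower 3 (a - 1)); [apply Rle_Rpower_l; lra|].
      rewrite <- (Rpower_1 3) at 2 by lra. apply Rle_Rpower; lra. }
    assert (HP0 : 0 < Rpower (Cmod w) (a - 1)) by apply exp_pos.
    assert (Hae : 0 <= a * e <= 2 * e) by nra. nra. }
  assert (Hre : Rabs (Re (f 0) - Re (f 1)) <= 6 * e * Rabs (0 - 1)).
  { apply (bounded_variation (fun t => Re (f t)) (Derive (fun t => Re (f t)))). intros t Ht.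
    replace (Rabs (0 - 1)) with 1 in Ht by (rewrite Rabs_left; lra).
    apply Rabs_le_between in Ht.
    destruct (Hf t ltac:(lra)) as [D [D1 [_ D3]]].
    split; [apply Derive_correct; now exists (Re D)|].
    rewrite (is_derive_unique (fun t : R => Re (f t)) t (Re D) D1).
    eapply Rle_trans; [apply re_le_Cmod|exact D3]. }
  assert (Him : Rabs (Im (f 0) - Im (f 1)) <= 6 * e * Rabs (0 - 1)).
  { apply (bounded_variation (fun t => Im (f t)) (Derive (fun t => Im (f t)))). intros t Ht.
    replace (Rabs (0 - 1)) with 1 in Ht by (rewrite Rabs_left; lra).
    apply Rabs_le_between in Ht.
    destruct (Hf t ltac:(lra)) as [D [_ [D2 D3]]].
    split; [apply Derive_correct; now exists (Im D)|].
    rewrite (is_derive_unique (fun t : R => Im (f t)) t (Im D) D2).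
    eapply Rle_trans; [apply im_le_Cmod|exact D3]. }
  replace (Rabs (0 - 1)) with 1 in Hre, Him by (rewrite Rabs_left; lra).
  replace (Cpower (z + RtoC e) a) with (f 1) by (unfold f; f_equal; ring).
  replace (Cpower z a) with (f 0) by (unfold f; f_equal; ring).
  set (d := (f 1 - f 0)%C).
  assert (Hd : d = (RtoC (Re d) + Ci * RtoC (Im d))%C).
  { destruct d as [d1 d2]. unfold Ci, Cplus, Cmult, RtoC; simpl. f_equal; ring. }
  rewrite Hd. eapply Rle_trans; [apply Cmod_triangle|].
  rewrite Cmod_mult, !Cmod_R.
  replace (Cmod Ci) with 1.
  2:{ unfold Cmod, Ci; simpl. replace (_ + _) with 1 by ring. now rewrite sqrt_1. }
  rewrite Rabs_minus_sym in Hre, Him.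
  change (Re d) with (Re (f 1) - Re (f 0)). change (Im d) with (Im (f 1) - Im (f 0)).
  lra.
Qed.

(** * Convergence of a family of expansions *)

Lemma trunc_close (a b : nat -> R) (u : C) (N : nat) : Cmod u <= 1 ->
  Cmod (trunc a u N - trunc b u N) <= sum_n (fun n => Rabs (a n - b n)) N.
Proof.
  intros Hu. induction N as [|N IH].
  - rewrite !trunc_O, sum_O, <- RtoC_minus, Cmod_R. lra.
  - rewrite !trunc_S, sum_Sn.
    replace (trunc a u N + RtoC (a (S N)) * u ^ S N -
             (trunc b u N + RtoC (b (S N)) * u ^ S N))%C
      with ((trunc a u N - trunc b u N) + RtoC (a (S N) - b (S N)) * u ^ S N)%C
      by (rewrite RtoC_minus; ring).
    eapply Rle_trans; [apply Cmod_triangle|]. apply Rplus_le_compat; [exact IH|].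
    rewrite Cmod_mult, Cmod_R.
    assert (H := Cmod_pow_le_1 (S N) u Hu).
    assert (H0 := Rabs_pos (a (S N) - b (S N))). nra.
Qed.

(* The [n]-th coefficient is, up to [O(v)], the [n]-th divided remainder at a small
   fixed [v > 0]. *)
Lemma coef_convergence {T : Type} (F : (T -> Prop) -> Prop) {FF : Filter F}
  (Phi : T -> R -> C) (psi : R -> C) (a : T -> nat -> R) (c : nat -> R) (M : R) :
  0 <= M ->
  F (fun x => a x O = c O) ->
  F (fun x => forall v N, 0 < v <= 1 / 2 ->
       Cmod (Phi x v - trunc (a x) (RtoC v) (S N)) <= M * v ^ S (S N)) ->
  (forall v N, 0 < v <= 1 / 2 ->
       Cmod (psi v - trunc c (RtoC v) (S N)) <= M * v ^ S (S N)) ->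
  (forall v eps, 0 < v <= 1 / 2 -> 0 < eps -> F (fun x => Cmod (Phi x v - psi v) < eps)) ->
  forall N eps, 0 < eps -> F (fun x => sum_n (fun n => Rabs (a x n - c n)) N < eps).
Proof.
  intros HM H0 HPhi Hpsi Hlim N.
  induction N as [|N IH]; intros eps Heps.
  - revert H0. apply filter_imp. intros x Hx.
    rewrite sum_O, Hx, Rminus_diag, Rabs_R0. exact Heps.
  (* v is fixed before the limit along F. After division by p = v^(N+1), the two remainders
     contribute 2 M v <= eps/4, and the lower coefficients and the difference of values eps/4 each.
     The last quarter pays for the previous sum. *)
  - set (v := Rmin (1 / 2) (eps / (8 * (M + 1)))).
    assert (Hv : 0 < v <= 1 / 2).
    { split; [apply Rmin_glb_lt; [lra|apply Rdiv_lt_0_compat; lra]|apply Rmin_l]. }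
    assert (HMv : 2 * M * v <= eps / 4).
    { assert (Hve : v <= eps / (8 * (M + 1))) by apply Rmin_r.
      apply Rle_trans with (2 * (M + 1) * v); [nra|].
      apply Rle_trans with (2 * (M + 1) * (eps / (8 * (M + 1)))).
      - apply Rmult_le_compat_l; lra.
      - right. field. lra. }
    assert (Hp : 0 < v ^ S N <= 1).
    { split; [apply pow_lt; lra|]. apply pow_unit_interval; lra. }
    set (p := v ^ S N) in *.
    assert (He' : 0 < eps / 4 * p) by (apply Rmult_lt_0_compat; lra).
    generalize (filter_and _ _ HPhi (filter_and _ _ (IH _ He') (Hlim v _ Hv He'))).
    apply filter_imp. intros x [B1 [B2 B3]].
    specialize (B1 v N Hv). assert (B4 := Hpsi v N Hv).
    assert (Hv1 : Cmod (RtoC v) <= 1) by (rewrite Cmod_R, Rabs_pos_eq; lra).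
    assert (B5 := trunc_close (a x) c (RtoC v) N Hv1).
    rewrite sum_Sn. unfold plus; simpl.
    change (v ^ S (S N)) with (v * p) in B1, B4.
    rewrite trunc_S in B1, B4.
    set (A := trunc (a x) (RtoC v) N) in *. set (B := trunc c (RtoC v) N) in *.
    assert (E : Rabs (a x (S N) - c (S N)) * p <=
      Cmod (Phi x v - psi v) + Cmod (A - B) + 2 * (M * (v * p))).
    { replace (Rabs (a x (S N) - c (S N)) * p)
        with (Cmod (RtoC (a x (S N) - c (S N)) * RtoC v ^ S N)).
      2:{ rewrite Cmod_mult, Cmod_pow, !Cmod_R, (Rabs_pos_eq v) by lra. reflexivity. }
      replace (RtoC (a x (S N) - c (S N)) * RtoC v ^ S N)%C
        with ((Phi x v - psi v) + - (A - B)
          + (- (Phi x v - (A + RtoC (a x (S N)) * RtoC v ^ S N))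
             + (psi v - (B + RtoC (c (S N)) * RtoC v ^ S N))))%C
        by (rewrite RtoC_minus; ring).
      eapply Rle_trans; [apply Cmod_triangle|].
      apply Rplus_le_compat.
      - eapply Rle_trans; [apply Cmod_triangle|]. rewrite Cmod_opp. lra.
      - eapply Rle_trans; [apply Cmod_triangle|]. rewrite Cmod_opp. lra. }
    assert (Hfin : Rabs (a x (S N) - c (S N)) <= 3 / 4 * eps).
    { apply Rmult_le_reg_r with p; [lra|].
      assert (2 * M * v * p <= eps / 4 * p) by (apply Rmult_le_compat_r; lra). lra. }
    assert (eps / 4 * p <= eps / 4) by nra. lra.
Qed.

(** N is chosen from rho alone, making both remainders at most eps/4 on the whole disc; then only
    finitely many coefficients have to converge. *)
Lemma uniform_convergence {T : Type} (F : (T -> Prop) -> Prop) {FF : Filter F}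
  (Phi : T -> C -> C) (psi : C -> C) (a : T -> nat -> R) (c : nat -> R) (M rho : R) :
  0 <= rho < 1 ->
  F (fun x => forall u N, Cmod u <= rho ->
       Cmod (Phi x u - trunc (a x) u (S N)) <= M * Cmod u ^ S (S N)) ->
  (forall u N, Cmod u <= rho ->
       Cmod (psi u - trunc c u (S N)) <= M * Cmod u ^ S (S N)) ->
  (forall N eps, 0 < eps -> F (fun x => sum_n (fun n => Rabs (a x n - c n)) N < eps)) ->
  forall eps, 0 < eps ->
  F (fun x => forall u, Cmod u <= rho -> Cmod (Phi x u - psi u) < eps).
Proof.
  intros Hrho HPhi Hpsi Hcoef eps Heps.
  assert (HN : exists N, Rabs M * rho ^ S (S N) < eps / 4).
  { assert (HM := Rabs_pos M).
    assert (He : 0 < eps / (4 * (Rabs M + 1))) by (apply Rdiv_lt_0_compat; lra).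
    destruct (pow_lt_1_zero rho ltac:(rewrite Rabs_pos_eq; lra) _ He) as [N HN].
    exists N. specialize (HN (S (S N)) ltac:(lia)).
    assert (Hp : 0 <= rho ^ S (S N)) by (apply pow_le; lra).
    rewrite Rabs_pos_eq in HN by exact Hp.
    apply Rle_lt_trans with ((Rabs M + 1) * rho ^ S (S N)); [nra|].
    apply Rlt_le_trans with ((Rabs M + 1) * (eps / (4 * (Rabs M + 1)))).
    - apply Rmult_lt_compat_l; lra.
    - right. field. lra. }
  destruct HN as [N HN].
  assert (He : 0 < eps / 4) by lra.
  generalize (filter_and _ _ HPhi (Hcoef (S N) _ He)).
  apply filter_imp. intros x [B1 B2] u Hu.
  specialize (B1 u N Hu). assert (B3 := Hpsi u N Hu).
  assert (B4 := trunc_close (a x) c u (S N) ltac:(lra)).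
  assert (Hpow : M * Cmod u ^ S (S N) <= Rabs M * rho ^ S (S N)).
  { assert (Hu0 := Cmod_ge_0 u). apply Rle_trans with (Rabs M * Cmod u ^ S (S N)).
    - apply Rmult_le_compat_r; [now apply pow_le|apply Rle_abs].
    - apply Rmult_le_compat_l; [apply Rabs_pos|]. apply pow_incr. lra. }
  replace (Phi x u - psi u)%C
    with ((Phi x u - trunc (a x) u (S N)) + (trunc (a x) u (S N) - trunc c u (S N))
          + - (psi u - trunc c u (S N)))%C by ring.
  eapply Rle_lt_trans; [apply Cmod_triangle|]. rewrite Cmod_opp.
  eapply Rle_lt_trans; [apply Rplus_le_compat_r, Cmod_triangle|]. lra.
Qed.

(** * Regular variation of the real defect *)

Lemma filterlim_Rmult {T : Type} (F : (T -> Prop) -> Prop) {FF : Filter F}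
  (f g : T -> R) (lf lg : R) :
  filterlim f F (locally lf) -> filterlim g F (locally lg) ->
  filterlim (fun x => f x * g x) F (locally (lf * lg)).
Proof. intros Hf Hg. exact (filterlim_comp_2 _ _ _ Hf Hg (filterlim_mult lf lg)). Qed.

Lemma filterlim_Rinv {T : Type} (F : (T -> Prop) -> Prop) {FF : Filter F}
  (f : T -> R) (l : R) :
  l <> 0 -> filterlim f F (locally l) -> filterlim (fun x => / f x) F (locally (/ l)).
Proof.
  intros Hl Hf. apply (filterlim_comp _ _ _ _ _ _ _ _ Hf).
  apply (filterlim_Rbar_inv l). intros E. now injection E.
Qed.

Lemma filterlim_Rabs_lt {T : Type} (F : (T -> Prop) -> Prop) {FF : Filter F}
  (f : T -> R) (l eps : R) :
  0 < eps -> filterlim f F (locally l) -> F (fun x => Rabs (f x - l) < eps).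
Proof.
  intros Heps Hf. exact (proj1 (filterlim_locally f l) Hf (mkposreal eps Heps)).
Qed.

Lemma at_right_0_lt (d : R) : 0 < d -> at_right 0 (fun r => 0 < r < d).
Proof.
  intros Hd. exists (mkposreal d Hd). intros y Hy Hpos. split; [exact Hpos|].
  change (Rabs (y - 0) < d) in Hy. rewrite Rminus_0_r in Hy.
  eapply Rle_lt_trans; [apply Rle_abs|exact Hy].
Qed.

Lemma at_right_0_scale (c : R) :
  0 < c -> filterlim (fun r => c * r) (at_right 0) (at_right 0).
Proof.
  intros Hc P [d Hd].
  assert (Hdc : 0 < d / c) by (apply Rdiv_lt_0_compat; [apply cond_pos|exact Hc]).
  apply filter_imp with (2 := at_right_0_lt _ Hdc). intros r Hr.
  assert (Hcr : 0 < c * r < d).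
  { split; [apply Rmult_lt_0_compat; lra|].
    replace (pos d) with (c * (d / c)) by (field; lra). apply Rmult_lt_compat_l; lra. }
  apply Hd; [|lra]. change (Rabs (c * r - 0) < d).
  rewrite Rminus_0_r, Rabs_pos_eq; lra.
Qed.

Definition regularly_varying_at_0 (g : R -> R) (a : R) : Prop :=
  at_right 0 (fun r => 0 < g r) /\
  forall c, 0 < c -> filterlim (fun r => g (c * r) / g r) (at_right 0) (locally (Rpower c a)).

Lemma regularly_varying_of_equiv (g L : R -> R) (a : R) :
  slowly_varying L ->
  filterlim (fun r => g r / (Rpower r a * L (1 / r))) (at_right 0) (locally 1) ->
  regularly_varying_at_0 g a.
Proof.
  intros [Lpos Lsv] Hq. set (q := fun r => g r / (Rpower r a * L (1 / r))) in Hq.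
  assert (Hden : forall r, 0 < r -> 0 < Rpower r a * L (1 / r)).
  { intros r Hr. apply Rmult_lt_0_compat; [apply exp_pos|]. apply Lpos.
    left. now apply Rdiv_lt_0_compat; [lra|]. }
  assert (Hpos : at_right 0 (fun r => 0 < r /\ 0 < g r)).
  { generalize (filter_and _ _ (at_right_0_lt 1 Rlt_0_1)
      (filterlim_Rabs_lt _ q 1 1 Rlt_0_1 Hq)).
    apply filter_imp. intros r [Hr Hqr]. split; [lra|].
    apply Rabs_lt_between in Hqr. specialize (Hden r ltac:(lra)).
    replace (g r) with (q r * (Rpower r a * L (1 / r)))
      by (unfold q, Rdiv at 1; rewrite Rmult_assoc, Rinv_l, Rmult_1_r; lra).
    apply Rmult_lt_0_compat; lra. }
  split.
  { revert Hpos. apply filter_imp. tauto. }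
  intros c Hc.
  apply filterlim_ext_loc
    with (fun r => q (c * r) * / q r * (Rpower c a * (L (/ c * (1 / r)) / L (1 / r)))).
  - revert Hpos. apply filter_imp. intros r [Hr Hg]. unfold q.
    replace (/ c * (1 / r)) with (1 / (c * r)) by (field; lra).
    assert (H1 := Hden r Hr). assert (H2 := Hden (c * r) ltac:(now apply Rmult_lt_0_compat)).
    rewrite <- (Rpower_mult_distr c r a Hc Hr).
    assert (0 < Rpower c a) by apply exp_pos. assert (0 < Rpower r a) by apply exp_pos.
    assert (0 < L (1 / r)) by (apply Lpos; left; apply Rdiv_lt_0_compat; lra).
    assert (0 < L (1 / (c * r))).
    { apply Lpos. left. apply Rdiv_lt_0_compat; [lra|now apply Rmult_lt_0_compat]. }
    field. repeat split; lra.
  - assert (H1 := filterlim_comp _ _ _ _ _ _ _ _ (at_right_0_scale c Hc) Hq).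
    assert (H2 := filterlim_Rinv (at_right 0) q 1 R1_neq_R0 Hq).
    assert (Hinv : filterlim (fun r => 1 / r) (at_right 0) (Rbar_locally' p_infty)).
    { apply filterlim_ext with (fun r => / r); [intros r; unfold Rdiv; ring|].
      exact filterlim_Rinv_0_right. }
    assert (H3 := filterlim_comp _ _ _ _ _ _ _ _ Hinv (Lsv (/ c) (Rinv_0_lt_compat c Hc))).
    assert (H := filterlim_Rmult _ _ _ _ _ (filterlim_Rmult _ _ _ _ _ H1 H2)
      (filterlim_Rmult _ _ _ _ _ (filterlim_const (Rpower c a)) H3)).
    replace (1 * / 1 * (Rpower c a * 1)) with (Rpower c a) in H by field.
    exact H.
Qed.

Lemma real_defect_equiv (mu : nat -> R) (phi : R -> R) :
  probability_distribution mu -> (forall r, 0 < r -> phi r <> 0) ->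
  equivalent (at_right 0) (fun s : R => defect mu (RtoC s)) (fun s : R => RtoC (phi s)) ->
  filterlim (fun r => real_defect mu r / phi r) (at_right 0) (locally 1).
Proof.
  intros Hmu Hphi H. apply filterlim_locally. intros eps.
  generalize (filter_and _ _ (at_right_0_lt 1 Rlt_0_1)
    (proj1 (filterlim_locally (U := C_UniformSpace) _ _) H eps)).
  apply filter_imp. intros r [Hr Hb].
  rewrite defect_RtoC, <- RtoC_div in Hb by (try apply Hphi; lra || assumption).
  (* A ball of the product structure on C is a square, so its first component is the real
     statement. *)
  exact (proj1 Hb).
Qed.

(* Halving the argument divides [g] by about [2^a > 2], so [g (s / 2^n)] is
   eventually smaller than any multiple of [s / 2^n]. *)
Lemma regularly_varying_small (g : R -> R) (a eps delta : R) :
  regularly_varying_at_0 g a -> 1 < a -> 0 < eps -> 0 < delta ->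
  exists s, 0 < s < delta /\ s <= 1 /\ Rabs (g s) <= eps * s.
Proof.
  intros [Hpos Hrv] Ha Heps Hdelta.
  set (h := Rpower (/ 2) a).
  assert (Hh : 0 < h < / 2).
  { split; [apply exp_pos|]. unfold h.
    rewrite <- (Rpower_1 (/ 2)) at 2 by lra. unfold Rpower.
    apply exp_increasing. assert (ln (/ 2) < 0) by (rewrite <- ln_1; apply ln_increasing; lra).
    nra. }
  (* Strictly between 2^(-a) and 1/2: q > h leaves room for the limit, and 2q < 1 makes g(s/2^n) /
     (s/2^n) decay like (2q)^n. *)
  set (q := (h + / 2) / 2).
  assert (Hm : 0 < Rmin delta 1) by (apply Rmin_glb_lt; lra).
  assert (Hev : at_right 0 (fun r => 0 < r < Rmin delta 1 /\ 0 < g r /\ g (/ 2 * r) <= q * g r)).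
  { assert (Hqh : 0 < q - h) by (unfold q; lra).
    assert (H2 : 0 < / 2) by lra.
    generalize (filter_and _ _ (at_right_0_lt _ Hm) (filter_and _ _ Hpos
      (filterlim_Rabs_lt (at_right 0) _ _ _ Hqh (Hrv (/ 2) H2)))).
    apply filter_imp. intros r [H1 [Hg H3]]. split; [exact H1|split; [exact Hg|]].
    apply Rabs_lt_between in H3. fold h in H3.
    replace (g (/ 2 * r)) with (g (/ 2 * r) / g r * g r) by (field; lra).
    apply Rmult_le_compat_r; lra. }
  destruct Hev as [d Hd].
  assert (Hd' : forall r, 0 < r < d ->
    0 < r < Rmin delta 1 /\ 0 < g r /\ g (/ 2 * r) <= q * g r).
  { intros r Hr. apply Hd; [|lra]. change (Rabs (r - 0) < d).
    rewrite Rminus_0_r, Rabs_pos_eq; lra. }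
  set (s := d / 2). assert (Hs : 0 < s < d) by (unfold s; generalize (cond_pos d); lra).
  assert (Hsn : forall n, 0 < s * (/ 2) ^ n < d).
  { intros n. assert (H := pow_unit_interval (/ 2) n ltac:(lra)).
    assert (0 < (/ 2) ^ n) by (apply pow_lt; lra). nra. }
  assert (Hit : forall n, g (s * (/ 2) ^ n) <= g s * q ^ n).
  { induction n as [|n IH]; [simpl; rewrite !Rmult_1_r; lra|].
    destruct (Hd' _ (Hsn n)) as [_ [_ H]].
    replace (s * (/ 2) ^ S n) with (/ 2 * (s * (/ 2) ^ n)) by (simpl; ring).
    apply Rle_trans with (1 := H). simpl.
    replace (g s * (q * q ^ n)) with (q * (g s * q ^ n)) by ring.
    apply Rmult_le_compat_l; [unfold q; lra|exact IH]. }
  destruct (Hd' s Hs) as [_ [Hgs _]].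
  assert (He : 0 < eps * s / g s).
  { apply Rdiv_lt_0_compat; [apply Rmult_lt_0_compat; lra|exact Hgs]. }
  destruct (pow_lt_1_zero (2 * q) ltac:(unfold q; rewrite Rabs_pos_eq; lra) _ He) as [n Hn].
  specialize (Hn n (le_n n)). rewrite Rabs_pos_eq in Hn by (apply pow_le; unfold q; lra).
  exists (s * (/ 2) ^ n). destruct (Hd' _ (Hsn n)) as [H1 [H2 _]].
  assert (Hml := Rmin_l delta 1). assert (Hmr := Rmin_r delta 1).
  split; [lra|split; [lra|]]. rewrite Rabs_pos_eq by lra.
  apply Rle_trans with (1 := Hit n).
  assert (H2n : 0 < (/ 2) ^ n) by (apply pow_lt; lra).
  replace (g s * q ^ n) with (g s * ((/ 2) ^ n * (2 * q) ^ n)).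
  2:{ rewrite <- Rpow_mult_distr. f_equal. f_equal. field. }
  replace (eps * (s * (/ 2) ^ n)) with (g s * ((/ 2) ^ n * (eps * s / g s))) by (field; lra).
  apply Rmult_le_compat_l; [lra|]. apply Rmult_le_compat_l; lra.
Qed.

(** * Asymptotics of the defect inside a disc, then up to the circle *)

Lemma trunc_div (a : nat -> R) (g : R) (u : C) (N : nat) :
  g <> 0 -> trunc (fun n => a n / g) u N = (trunc a u N / RtoC g)%C.
Proof.
  intros Hg. assert (Hg' : RtoC g <> RtoC 0) by (intros E; now apply Hg, RtoC_inj).
  induction N as [|N IH].
  - rewrite !trunc_O, RtoC_div by exact Hg. reflexivity.
  - rewrite !trunc_S, IH, RtoC_div by exact Hg. field. exact Hg'.
Qed.

Lemma normalized_taylor (mu : nat -> R) (r : R) (u : C) (N : nat) :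
  probability_distribution mu -> is_series (fun k => mu k * INR k) 1 ->
  0 < r <= 1 -> 0 < real_defect mu r -> Cmod u <= 1 ->
  Cmod (defect mu (RtoC r * (1 - u)) / RtoC (real_defect mu r)
        - trunc (fun n => defect_coef mu r n / real_defect mu r) u (S N))
  <= 6 * Cmod u ^ S (S N).
Proof.
  intros Hmu Hmean Hr Hg Hu.
  assert (H := defect_taylor mu r u N Hmu Hmean ltac:(lra) Hu).
  set (g := real_defect mu r) in *.
  assert (Hg' : RtoC g <> RtoC 0) by (intros E; apply RtoC_inj in E; lra).
  rewrite trunc_div by lra.
  replace (defect mu (RtoC r * (1 - u)) / RtoC g - trunc (defect_coef mu r) u (S N) / RtoC g)%C
    with ((defect mu (RtoC r * (1 - u)) - trunc (defect_coef mu r) u (S N)) / RtoC g)%C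
    by (field; exact Hg').
  rewrite Cmod_div, Cmod_R, Rabs_pos_eq by (exact Hg' || lra).
  apply Rmult_le_reg_r with g; [exact Hg|].
  unfold Rdiv. rewrite Rmult_assoc, Rinv_l, Rmult_1_r by lra. lra.
Qed.

Lemma defect_coef_limit (mu : nat -> R) (alpha : R) :
  probability_distribution mu -> is_series (fun k => mu k * INR k) 1 ->
  0 <= alpha <= 2 -> regularly_varying_at_0 (real_defect mu) alpha ->
  forall N eps, 0 < eps -> at_right 0 (fun r =>
    sum_n (fun n => Rabs (defect_coef mu r n / real_defect mu r - binom_coef alpha n)) N < eps).
Proof.
  intros Hmu Hmean Ha [Hpos Hrv].
  apply (coef_convergence (at_right 0)
    (fun r v => defect mu (RtoC r * (1 - RtoC v)) / RtoC (real_defect mu r))%C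
    (fun v => Cpower (1 - RtoC v) alpha)
    (fun r n => defect_coef mu r n / real_defect mu r) (binom_coef alpha) 6).
  - lra.
  - revert Hpos. apply filter_imp. intros r Hr. rewrite defect_coef_0. simpl. field. lra.
  - generalize (filter_and _ _ Hpos (at_right_0_lt 1 Rlt_0_1)). apply filter_imp.
    intros r [Hg Hr] v N Hv.
    assert (Hvm : Cmod (RtoC v) = v) by (rewrite Cmod_R, Rabs_pos_eq; lra).
    rewrite <- Hvm at 3. apply normalized_taylor; try assumption; lra.
  - intros v N Hv.
    assert (Hvm : Cmod (RtoC v) = v) by (rewrite Cmod_R, Rabs_pos_eq; lra).
    assert (H := binomial_remainder alpha (RtoC v) (S N) Ha ltac:(lra)).
    rewrite Hvm in H. eapply Rle_trans; [exact H|].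
    (* For v <= 1/2 the binomial constant 2/(1-v) is at most 4, so the 6 of the defect serves for
       both expansions. *)
    apply Rmult_le_compat_r; [apply pow_le; lra|].
    apply Rmult_le_reg_r with (1 - v); [lra|].
    unfold Rdiv. rewrite Rmult_assoc, Rinv_l by lra. lra.
  (* For real v the point r(1-v) is real, and this is exactly regular variation with factor 1-v. *)
  - intros v eps Hv Heps.
    generalize (filter_and _ _ (filter_and _ _ Hpos (at_right_0_lt 1 Rlt_0_1))
      (filterlim_Rabs_lt (at_right 0) _ _ eps Heps (Hrv (1 - v) ltac:(lra)))).
    apply filter_imp. intros r [[Hg Hr] H].
    rewrite <- (RtoC_minus 1 v), <- RtoC_mult, defect_RtoC by (assumption || nra).
    rewrite Cpower_RtoC by lra.
    rewrite <- RtoC_div, <- RtoC_minus, Cmod_R by lra.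
    now rewrite (Rmult_comm r).
Qed.

Lemma defect_disc_limit (mu : nat -> R) (alpha rho eps : R) :
  probability_distribution mu -> is_series (fun k => mu k * INR k) 1 ->
  0 <= alpha <= 2 -> regularly_varying_at_0 (real_defect mu) alpha ->
  0 <= rho < 1 -> 0 < eps ->
  at_right 0 (fun r => forall u, Cmod u <= rho ->
    Cmod (defect mu (RtoC r * (1 - u)) / RtoC (real_defect mu r) - Cpower (1 - u) alpha) < eps).
Proof.
  intros Hmu Hmean Ha Hrv Hrho Heps.
  assert (HM : 0 <= 2 / (1 - rho)) by (apply Rlt_le, Rdiv_lt_0_compat; lra).
  apply (uniform_convergence (at_right 0)
    (fun r u => defect mu (RtoC r * (1 - u)) / RtoC (real_defect mu r))%C
    (fun u => Cpower (1 - u) alpha)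
    (fun r n => defect_coef mu r n / real_defect mu r) (binom_coef alpha)
    (6 + 2 / (1 - rho)) rho Hrho).
  - generalize (filter_and _ _ (proj1 Hrv) (at_right_0_lt 1 Rlt_0_1)). apply filter_imp.
    intros r [Hg Hr] u N Hu.
    eapply Rle_trans; [apply normalized_taylor; try assumption; lra|].
    apply Rmult_le_compat_r; [apply pow_le, Cmod_ge_0|lra].
  - intros u N Hu.
    eapply Rle_trans; [apply binomial_remainder; lra|].
    apply Rmult_le_compat_r; [apply pow_le, Cmod_ge_0|].
    apply Rle_trans with (2 / (1 - rho)); [|lra].
    apply Rmult_le_compat_l; [lra|]. apply Rinv_le_contravar; lra.
  - now apply defect_coef_limit.
  - exact Heps.
Qed.

Lemma Cmod_sqr (z : C) : Cmod z * Cmod z = Re z * Re z + Im z * Im z.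
Proof. unfold Cmod. rewrite sqrt_sqrt; unfold Re, Im; nra. Qed.

Lemma Cmod_one_minus_sqr (z : C) :
  Cmod (1 - z) * Cmod (1 - z) = 1 - 2 * Re z + Cmod z * Cmod z.
Proof. rewrite !Cmod_sqr. destruct z as [x y]. simpl. ring. Qed.

Lemma Re_pos_of_unit_disc (s : C) : Cmod (1 - s) < 1 -> 0 < Re s.
Proof.
  intros H. assert (E := Cmod_one_minus_sqr s). assert (H0 := Cmod_ge_0 (1 - s)).
  assert (0 <= Cmod s * Cmod s) by apply Rle_0_sqr. nra.
Qed.

(* A point [s] of the disc may approach the circle tangentially, where the disc
   estimate fails.  Shifting it to [s + e |s|] costs little by the Lipschitz bound and
   moves it to [r (1 - u)] with [r = (4/e) |s|] and [|u|] bounded away from 1. *)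
Lemma defect_tangential_limit (mu : nat -> R) (alpha eta : R) :
  probability_distribution mu -> is_series (fun k => mu k * INR k) 1 ->
  1 <= alpha <= 2 -> regularly_varying_at_0 (real_defect mu) alpha -> 0 < eta ->
  at_right 0 (fun m => forall s, Cmod s = m -> Cmod (1 - s) < 1 ->
    Cmod (defect mu s - RtoC (real_defect mu m) * Cpower (RtoC (/ m) * s) alpha)
    <= eta * real_defect mu m).
Proof.
  intros Hmu Hmean Ha Hrv Heta. assert (Hpos := proj1 Hrv).
  set (g := real_defect mu) in *.
  (* 47 = 30 + 1 + 4 + 12, the costs of [T1] to [T4] in units of e g(m). *)
  set (e := Rmin 1 (eta / 47)).
  assert (He : 0 < e <= 1 /\ 47 * e <= eta).
  { assert (H := Rmin_r 1 (eta / 47)). fold e in H.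
    repeat split; [apply Rmin_glb_lt; lra|apply Rmin_l|lra]. }
  destruct He as [He Heeta].
  set (K := 4 / e). assert (HK : 4 <= K).
  { unfold K. apply Rmult_le_reg_r with e; [lra|].
    unfold Rdiv. rewrite Rmult_assoc, Rinv_l by lra. lra. }
  assert (HKe : K * e = 4) by (unfold K; field; lra).
  set (Ka := Rpower K alpha). assert (HKa : 0 < Ka) by apply exp_pos.
  (* With Re Z >= e and |Z| <= 2, |u|^2 = 1 - (e/2) Re Z + (e/4)^2 |Z|^2 <= 1 - e^2/4 <= rho^2. *)
  set (rho := 1 - e * e / 8). assert (Hrho : 0 <= rho < 1) by (unfold rho; nra).
  (* The disc estimate is multiplied by g(r) <= 2 Ka g(m), which brings this tolerance back to e
     g(m). *)
  assert (He' : 0 < e / (2 * Ka)) by (apply Rdiv_lt_0_compat; lra).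
  assert (HeKa : 0 < e * Ka) by (apply Rmult_lt_0_compat; lra).
  assert (Hscale := at_right_0_scale K ltac:(lra)).
  assert (Eg2 := filterlim_Rabs_lt (at_right 0) _ _ 1 Rlt_0_1 (proj2 Hrv 2 ltac:(lra))).
  assert (EgK := filterlim_Rabs_lt (at_right 0) _ _ _ HeKa (proj2 Hrv K ltac:(lra))).
  assert (ED := Hscale _ (filter_and _ _ Hpos
    (defect_disc_limit mu alpha rho _ Hmu Hmean ltac:(lra) Hrv Hrho He'))).
  (* The bound m < e/4 keeps the shifted point in the closed disc: |1-s'|^2 <= 1 - 2 e m + 4 m^2 <=
     1. *)
  assert (Hd : 0 < e / 4) by lra.
  generalize (filter_and _ _ (filter_and _ _ Hpos (at_right_0_lt _ Hd))
    (filter_and _ _ (filter_and _ _ Eg2 EgK) ED)).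
  apply filter_imp. intros m [[Hg Hm] [[B2 BK] [HgK BD]]] s Hsm Hs1.
  fold g in BD. fold Ka in BK.
  set (r := K * m) in *.
  assert (Hre := Re_pos_of_unit_disc s Hs1).
  set (z := (RtoC (/ m) * s)%C).
  assert (Hzm : Cmod z = 1).
  { unfold z. rewrite Cmod_mult, Cmod_R, Hsm, Rabs_pos_eq.
    - field. lra.
    - left. apply Rinv_0_lt_compat. lra. }
  assert (Hrez : 0 < Re z).
  { unfold z. rewrite re_scal_l. apply Rmult_lt_0_compat; [apply Rinv_0_lt_compat; lra|exact Hre]. }
  set (Z := (z + RtoC e)%C).
  assert (HZre : e <= Re Z) by (change (Re Z) with (Re z + e); lra).
  assert (HZm : Cmod Z <= 2).
  { unfold Z. eapply Rle_trans; [apply Cmod_triangle|].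
    rewrite Cmod_R, Rabs_pos_eq; lra. }
  assert (HZ0 := Cmod_ge_0 Z).
  assert (Hmc : RtoC m <> RtoC 0) by (intros E; apply RtoC_inj in E; lra).
  assert (HKc : RtoC K <> RtoC 0) by (intros E; apply RtoC_inj in E; lra).
  set (s' := (s + RtoC (e * m))%C).
  set (u := (1 - RtoC (/ K) * Z)%C).
  assert (Hs'u : (RtoC r * (1 - u))%C = s').
  { unfold s', u, Z, z, r. rewrite !RtoC_mult, !RtoC_inv by lra. field. now split. }
  assert (Hu : Cmod u <= rho).
  { assert (E := Cmod_one_minus_sqr (RtoC (/ K) * Z)). fold u in E.
    rewrite re_scal_l, Cmod_mult, Cmod_R, Rabs_pos_eq in E
      by (left; apply Rinv_0_lt_compat; lra).
    replace (/ K) with (e / 4) in E by (unfold K; field; lra).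
    assert (Hu0 := Cmod_ge_0 u).
    assert (H1 : Cmod Z * Cmod Z <= 4) by nra.
    assert (H2 : e * e <= e * Re Z) by (apply Rmult_le_compat_l; lra).
    assert (H3 : e * e * (Cmod Z * Cmod Z) <= e * e * 4) by (apply Rmult_le_compat_l; nra).
    assert (H4 : Cmod u * Cmod u <= rho * rho).
    { rewrite E. unfold rho. assert (0 <= e * e * (e * e)) by nra. lra. }
    apply Rsqr_incr_0_var; [exact H4|lra]. }
  specialize (BD u Hu). rewrite Hs'u in BD.
  assert (HP : Cpower (1 - u) alpha = (RtoC (/ Ka) * Cpower Z alpha)%C).
  { replace (1 - u)%C with (RtoC (/ K) * Z)%C by (unfold u; ring).
    rewrite Cpower_scale by (try apply Rinv_0_lt_compat; lra).
    f_equal. f_equal. unfold Ka, Rpower. rewrite ln_Rinv, <- exp_Ropp by lra.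
    f_equal. ring. }
  rewrite HP in BD.
  change (0 < g r) in HgK.
  assert (HgKc : RtoC (g r) <> RtoC 0).
  { intros E; apply RtoC_inj in E. lra. }
  (* The Lipschitz bound at radius 2m costs 6 e g(2m), and g(2m) <= (2^alpha + 1) g(m) <= 5 g(m). *)
  assert (T1 : Cmod (defect mu s - defect mu s') <= 30 * e * g m).
  { assert (Hs'1 : Cmod (1 - s') <= 1).
    { assert (E := Cmod_one_minus_sqr s').
      assert (Cmod s' <= 2 * m).
      { unfold s'. eapply Rle_trans; [apply Cmod_triangle|].
        rewrite Cmod_R, Rabs_pos_eq by nra. nra. }
      assert (e * m <= Re s') by (change (Re s') with (Re s + e * m); lra).
      assert (Hs'0 := Cmod_ge_0 s').
      assert (Cmod s' * Cmod s' <= 2 * m * (2 * m)) by nra.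
      assert (2 * m * (2 * m) <= e * m) by nra.
      assert (Cmod (1 - s') * Cmod (1 - s') <= 1) by nra.
      apply Rsqr_incr_0_var; [unfold Rsqr; lra|lra]. }
    assert (Hs'2 : Cmod s' <= 2 * m).
    { unfold s'. eapply Rle_trans; [apply Cmod_triangle|].
      rewrite Cmod_R, Rabs_pos_eq by nra. nra. }
    assert (H := defect_lipschitz mu s s' (2 * m) Hmu Hmean ltac:(lra)
      ltac:(lra) Hs'1 ltac:(lra) Hs'2).
    replace (s - s')%C with (- RtoC (e * m))%C in H by (unfold s'; ring).
    rewrite Cmod_opp, Cmod_R, Rabs_pos_eq in H by nra.
    replace (12 * (e * m) / (2 * m)) with (6 * e) in H by (field; lra).
    fold g in H.
    assert (Hg2 : g (2 * m) <= 5 * g m).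
    { assert (Hp4 := Rpower_le_sqr 2 alpha ltac:(lra) ltac:(lra)).
      apply Rabs_lt_between in B2.
      replace (g (2 * m)) with (g (2 * m) / g m * g m) by (field; lra).
      apply Rmult_le_compat_r; lra. }
    eapply Rle_trans; [exact H|].
    apply Rle_trans with (5 * g m * (6 * e)); [apply Rmult_le_compat_r; lra|lra]. }
  assert (HgK' : Rabs (g r - Ka * g m) <= e * Ka * g m).
  { replace (g r - Ka * g m) with ((g r / g m - Ka) * g m) by (field; lra).
    rewrite Rabs_mult, (Rabs_pos_eq (g m)) by lra.
    apply Rmult_le_compat_r; [lra|]. lra. }
  assert (T2 : Cmod (defect mu s' - RtoC (g r) * (RtoC (/ Ka) * Cpower Z alpha)) <= e * g m).
  { replace (defect mu s' - RtoC (g r) * (RtoC (/ Ka) * Cpower Z alpha))%C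
      with (RtoC (g r) * (defect mu s' / RtoC (g r) - RtoC (/ Ka) * Cpower Z alpha))%C
      by (field; exact HgKc).
    rewrite Cmod_mult, Cmod_R, Rabs_pos_eq by lra.
    assert (Hgr : g r <= 2 * Ka * g m).
    { apply Rabs_le_between in HgK'.
      assert (0 < Ka * g m) by (apply Rmult_lt_0_compat; lra). nra. }
    apply Rle_trans with (2 * Ka * g m * (e / (2 * Ka))).
    - apply Rmult_le_compat; try lra. apply Cmod_ge_0.
    - right. field. lra. }
  assert (T3 : Cmod (RtoC (g r) * (RtoC (/ Ka) * Cpower Z alpha) - RtoC (g m) * Cpower Z alpha)
               <= 4 * e * g m).
  { replace (RtoC (g r) * (RtoC (/ Ka) * Cpower Z alpha) - RtoC (g m) * Cpower Z alpha)%C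
      with (RtoC ((g r - Ka * g m) * / Ka) * Cpower Z alpha)%C.
    2:{ replace ((g r - Ka * g m) * / Ka) with (g r * / Ka - g m) by (field; lra).
        rewrite RtoC_minus, RtoC_mult. ring. }
    rewrite Cmod_mult, Cmod_R, Rabs_mult, Cmod_Cpower.
    rewrite (Rabs_pos_eq (/ Ka)) by (left; apply Rinv_0_lt_compat; lra).
    assert (HZpos : 0 < Cmod Z).
    { apply Cmod_gt_0. intros E. rewrite E in HZre. simpl in HZre. lra. }
    assert (H4 : Rpower (Cmod Z) alpha <= 4).
    { apply Rle_trans with (Rpower 2 alpha); [apply Rle_Rpower_l; lra|].
      assert (H := Rpower_le_sqr 2 alpha ltac:(lra) ltac:(lra)). lra. }
    assert (H5 : Rabs (g r - Ka * g m) * / Ka <= e * g m).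
    { apply Rle_trans with (e * Ka * g m * / Ka).
      - apply Rmult_le_compat_r; [left; apply Rinv_0_lt_compat; lra|exact HgK'].
      - right. field. lra. }
    assert (H6 : 0 < Rpower (Cmod Z) alpha) by apply exp_pos.
    assert (0 <= e * g m) by nra.
    apply Rle_trans with (e * g m * 4); [|lra].
    apply Rmult_le_compat; try lra.
    apply Rmult_le_pos; [apply Rabs_pos|left; apply Rinv_0_lt_compat; lra]. }
  assert (T4 : Cmod (RtoC (g m) * Cpower Z alpha - RtoC (g m) * Cpower z alpha)
               <= 12 * e * g m).
  { replace (RtoC (g m) * Cpower Z alpha - RtoC (g m) * Cpower z alpha)%C
      with (RtoC (g m) * (Cpower Z alpha - Cpower z alpha))%C by ring.
    rewrite Cmod_mult, Cmod_R, Rabs_pos_eq by lra.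
    assert (H := Cpower_shift_le alpha e z Ha ltac:(lra) Hrez ltac:(lra)).
    fold Z in H.
    rewrite (Rmult_comm (12 * e)). apply Rmult_le_compat_l; lra. }
  replace (defect mu s - RtoC (g m) * Cpower z alpha)%C
    with ((defect mu s - defect mu s')
      + ((defect mu s' - RtoC (g r) * (RtoC (/ Ka) * Cpower Z alpha))
      + ((RtoC (g r) * (RtoC (/ Ka) * Cpower Z alpha) - RtoC (g m) * Cpower Z alpha)
      + (RtoC (g m) * Cpower Z alpha - RtoC (g m) * Cpower z alpha))))%C by ring.
  eapply Rle_trans; [apply Cmod_triangle|].
  eapply Rle_trans; [apply Rplus_le_compat_l, Cmod_triangle|].
  eapply Rle_trans; [apply Rplus_le_compat_l, Rplus_le_compat_l, Cmod_triangle|].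
  apply Rle_trans with (47 * e * g m); [lra|]. apply Rmult_le_compat_r; lra.
Qed.

Theorem theorem1p4 (mu : nat -> R) (alpha : R) (L : R -> R)
  (Hmu : probability_distribution mu)
  (Halpha : 1 < alpha <= 2)
  (HL : slowly_varying L)
  (Hequiv : equivalent (at_right 0)
     (fun s : R => gen_fun mu (1 - s) - (1 - s))%C
     (fun s : R => RtoC (Rpower s alpha * L (1 / s)))) :
  equivalent
    (within (fun w : C => Cmod (1 + w) < 1) (locally (T := C_UniformSpace) (RtoC 0)))
    (fun w : C => gen_fun mu (1 + w) - (1 + w))%C
    (fun w : C => Cpower (- w) alpha * RtoC (L (1 / Cmod w)%R))%C.
Proof.
  set (phi := fun r => Rpower r alpha * L (1 / r)).
  assert (Hphi : forall r, 0 < r -> 0 < phi r).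
  { intros r Hr. apply Rmult_lt_0_compat; [apply exp_pos|]. apply HL.
    left. apply Rdiv_lt_0_compat; lra. }
  assert (Hratio : filterlim (fun r => real_defect mu r / phi r) (at_right 0) (locally 1)).
  { apply real_defect_equiv; [exact Hmu| |exact Hequiv].
    intros r Hr. specialize (Hphi r Hr). lra. }
  assert (Hrv := regularly_varying_of_equiv _ _ _ HL Hratio).
  assert (Hmean : is_series (fun k => mu k * INR k) 1).
  { apply mean_one; [exact Hmu|]. intros eps delta Heps Hdelta.
    now apply (regularly_varying_small _ alpha). }
  apply (filterlim_locally (U := C_UniformSpace)). intros eps.
  (* The final error is below eta g(m)/phi(m) + eta, with g(m)/phi(m) < 1 + eta <= 2, hence below 3
     eta < eps. *)
  set (eta := Rmin 1 (eps / 4)).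
  assert (Heta : 0 < eta <= 1 /\ 4 * eta <= eps).
  { assert (H := Rmin_r 1 (eps / 4)). fold eta in H. assert (He := cond_pos eps).
    repeat split; [apply Rmin_glb_lt; lra|apply Rmin_l|lra]. }
  destruct Heta as [Heta Hetaeps].
  destruct (filter_and _ _ (at_right_0_lt 1 Rlt_0_1) (filter_and _ _
    (filterlim_Rabs_lt (at_right 0) _ _ eta (proj1 Heta) Hratio)
    (defect_tangential_limit mu alpha eta Hmu Hmean ltac:(lra) Hrv (proj1 Heta))))
    as [d Hd].
  (* Neighbourhoods in C are squares; half-side d/2 ensures |w| <= |Re w| + |Im w| < d. *)
  exists (mkposreal _ (is_pos_div_2 d)). intros w [Hw1 Hw2] Hw.
  assert (Hwd : Cmod w < d).
  { change (Rabs (fst w - 0) < d / 2) in Hw1. change (Rabs (snd w - 0) < d / 2) in Hw2.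
    rewrite Rminus_0_r in Hw1, Hw2.
    replace w with (RtoC (fst w) + Ci * RtoC (snd w))%C.
    2:{ destruct w as [x y]. unfold Ci, Cplus, Cmult, RtoC; simpl. f_equal; ring. }
    eapply Rle_lt_trans; [apply Cmod_triangle|]. rewrite Cmod_mult, !Cmod_R.
    replace (Cmod Ci) with 1; [lra|].
    unfold Cmod, Ci; simpl. replace (_ + _) with 1 by ring. now rewrite sqrt_1. }
  set (s := (- w)%C).
  assert (Hs1 : Cmod (1 - s) < 1).
  { unfold s. replace (1 - - w)%C with (1 + w)%C by ring. exact Hw. }
  assert (Hsw : Cmod s = Cmod w) by apply Cmod_opp.
  assert (Hre := Re_pos_of_unit_disc s Hs1).
  set (m := Cmod w) in *.
  assert (Hm : 0 < m).
  { rewrite <- Hsw. apply Cmod_gt_0. intros E. rewrite E in Hre. simpl in Hre. lra. }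
  destruct (Hd m) as [_ [Hq HD]]; [|exact Hm|].
  { change (Rabs (m - 0) < d). rewrite Rminus_0_r, Rabs_pos_eq; lra. }
  specialize (HD s Hsw Hs1). specialize (Hphi m Hm).
  set (g := real_defect mu m) in *.
  set (P := Cpower (RtoC (/ m) * s) alpha) in *.
  assert (Hrez : 0 < Re (RtoC (/ m) * s)).
  { rewrite re_scal_l. apply Rmult_lt_0_compat; [now apply Rinv_0_lt_compat|exact Hre]. }
  assert (Hmc : RtoC m <> RtoC 0) by (intros E; apply RtoC_inj in E; lra).
  assert (HPm : Cmod P = 1).
  { unfold P. rewrite Cmod_Cpower, Cmod_mult, Cmod_R, Hsw, Rabs_pos_eq, Rinv_l
      by (try (left; apply Rinv_0_lt_compat); lra).
    unfold Rpower. now rewrite ln_1, Rmult_0_r, exp_0. }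
  assert (HP0 : P <> RtoC 0) by (apply Cmod_gt_0; lra).
  (* Factoring out the modulus leaves [P] of modulus 1, so the denominator has modulus phi(m) and
     the error eta g(m) becomes relative. *)
  assert (Hden : (Cpower s alpha * RtoC (L (1 / m)%R))%C = (RtoC (phi m) * P)%C).
  { replace s with (RtoC m * (RtoC (/ m) * s))%C at 1
      by (rewrite RtoC_inv by lra; field; exact Hmc).
    rewrite Cpower_scale by assumption. unfold phi. rewrite RtoC_mult. fold P. ring. }
  assert (Hphic : RtoC (phi m) <> RtoC 0) by (intros E; apply RtoC_inj in E; lra).
  assert (Hfinal : Cmod ((gen_fun mu (1 + w) - (1 + w)) /
    (Cpower (- w) alpha * RtoC (L (1 / m)%R)) - 1) < eps).
  { fold s. rewrite Hden.
    replace (gen_fun mu (1 + w) - (1 + w))%C with (defect mu s).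
    2:{ unfold defect, s. replace (1 - - w)%C with (1 + w)%C by ring. reflexivity. }
    replace (defect mu s / (RtoC (phi m) * P) - 1)%C
      with ((defect mu s - RtoC g * P) / (RtoC (phi m) * P) + RtoC (g / phi m - 1))%C
      by (rewrite RtoC_minus, RtoC_div by lra; field; now split).
    eapply Rle_lt_trans; [apply Cmod_triangle|].
    rewrite Cmod_div by now apply Cmult_neq_0.
    rewrite Cmod_mult, !Cmod_R, HPm, (Rabs_pos_eq (phi m)), Rmult_1_r by lra.
    apply Rabs_lt_between in Hq as Hq'.
    assert (Hmain : Cmod (defect mu s - RtoC g * P) / phi m <= eta * (g / phi m)).
    { replace (eta * (g / phi m)) with (eta * g / phi m) by (field; lra).
      apply Rmult_le_compat_r; [left; now apply Rinv_0_lt_compat|exact HD]. }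
    assert (eta * (g / phi m) <= eta * 2) by (apply Rmult_le_compat_l; lra).
    lra. }
  set (ratio := (_ / _)%C) in Hfinal.
  split.
  - change (Rabs (Re (ratio - 1)) < eps).
    eapply Rle_lt_trans; [apply re_le_Cmod|exact Hfinal].
  - change (Rabs (Im (ratio - 1)) < eps).
    eapply Rle_lt_trans; [apply im_le_Cmod|exact Hfinal].
Qed.
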